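(* Let $X$ be a real Banach space. If $A \subset \mathcal{B}(X)$ is a commutative algebra of essentially real operators, then there exists a non-trivial closed subspace of the dual space $X^*$, invariant for the algebra $A^* = \{T^* : T \in A\}$; that is, there is a norm-closed linear subspace $L \subset X^*$ with $L \neq \{0\}$, $L \neq X^*$ and $T^* L \subset L$ for every $T \in A$.
   Context: $\mathcal{B}(X)$ is the algebra of all bounded linear operators on the real Banach space $X$ (complex Banach spaces are regarded as real ones), $\mathcal{K}(X)$ is the ideal of compact operators, and $\mathcal{C}(X) = \mathcal{B}(X)/\mathcal{K}(X)$ is the Calkin algebra with its quotient norm; $\pi : \mathcal{B}(X) \to \mathcal{C}(X)$ is the quotient map. The essential norm is $\|T\|_e = \inf\{\|T+K\| : K \in \mathcal{K}(X)\} = \|\pi(T)\|$. An element $a$ of a unital normed algebra is called positive if $\|1 - \varepsilon a\| \le 1 + o(\varepsilon)$ for $\varepsilon > 0$, $\varepsilon \to 0$. An element $a$ is called real if $a^2$ is positive. An operator $T \in \mathcal{B}(X)$ is called essentially real if $\pi(T)$ is a real element of $\mathcal{C}(X)$, i.e. $\|1 - \varepsilon T^2\|_e \le 1 + o(\varepsilon)$ as $\varepsilon \searrow 0$. $T^*$ denotes the Banach space adjoint of $T$, acting on $X^*$.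
   Formalization: The space X is assumed infinite-dimensional: in finite dimension the Calkin algebra is {0}, every operator is essentially real, and the claim fails, e.g. for the algebra generated by a 90-degree rotation of the plane. *)

(* Defs.v *)
From HB Require Import structures.
From mathcomp Require Import all_boot all_order all_algebra.
From mathcomp Require Import all_classical all_reals all_analysis.
Set Implicit Arguments.
Unset Strict Implicit.
Unset Printing Implicit Defensive.
Import Order.TTheory GRing.Theory Num.Theory.
Import numFieldNormedType.Exports.
Local Open Scope classical_set_scope.
Local Open Scope ring_scope.

Section BoundedLinearMaps.
Context {R : realType}.
Implicit Types X Y Z : normedModType R.

Definition linear_continuous_fun X Y : {pred (X -> Y)} :=
  [pred f : X -> Y | `[< linear f /\ continuous f >]].

Record bounded_op X Y := BoundedOp {
  bop_fun :> X -> Y;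
  bop_subproof : bop_fun \in @linear_continuous_fun X Y }.

Section Structure.
Variables X Y : normedModType R.

HB.instance Definition _ := [isSub for @bop_fun X Y].
HB.instance Definition _ := [Choice of bounded_op X Y by <:].

Lemma linear_continuous_funP (f : X -> Y) :
  reflect (linear f /\ continuous f) (f \in @linear_continuous_fun X Y).
Proof. by rewrite inE; exact: asboolP. Qed.

Lemma linear_continuous_fun_submod :
  submod_closed (@linear_continuous_fun X Y).
Proof.
split.
  apply/linear_continuous_funP; split=> [a x y|x].
    by change (0 = a *: 0 + 0 :> Y); rewrite scaler0 addr0.
  exact: cvg_cst.
move=> a f g /linear_continuous_funP[lf cf] /linear_continuous_funP[lg cg].
apply/linear_continuous_funP; split=> [b x y|x].
  change (a *: f (b *: x + y) + g (b *: x + y) =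
          b *: (a *: f x + g x) + (a *: f y + g y)).
  rewrite lf lg !scalerDr !scalerA.
  by rewrite [a * b]mulrC addrACA.
apply: cvgD; last exact: cg.
by apply: cvgZl_tmp; exact: cf.
Qed.

HB.instance Definition _ := GRing.isSubmodClosed.Build R (X -> Y)
  (@linear_continuous_fun X Y) linear_continuous_fun_submod.
HB.instance Definition _ := [SubChoice_isSubLmodule of bounded_op X Y by <:].

Lemma bopP (f : bounded_op X Y) : linear f /\ continuous f.
Proof. by apply/linear_continuous_funP; exact: bop_subproof. Qed.

HB.instance Definition _ (f : bounded_op X Y) :=
  GRing.isLinear.Build R X Y *:%R (bop_fun f) (bopP f).1.

Lemma bop_continuous (f : bounded_op X Y) : continuous f.
Proof. exact: (bopP f).2. Qed.

Lemma bopD (f g : bounded_op X Y) x : (f + g) x = f x + g x.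
Proof. by []. Qed.

Lemma bopZ (a : R) (f : bounded_op X Y) x : (a *: f) x = a *: f x.
Proof. by []. Qed.

Lemma bopN (f : bounded_op X Y) x : (- f) x = - f x.
Proof. by []. Qed.

Lemma bop0 x : (0 : bounded_op X Y) x = 0.
Proof. by []. Qed.

Lemma bop_ext (f g : bounded_op X Y) : (forall x, f x = g x) -> f = g.
Proof. by move=> fg; apply/val_inj/funext. Qed.

Definition op_norm (f : bounded_op X Y) : R :=
  sup [set `|f x| | x in [set x : X | `|x| <= 1]].

Lemma op_norm_has_sup (f : bounded_op X Y) :
  has_sup [set `|f x| | x in [set x : X | `|x| <= 1]].
Proof.
split; first by exists `|f 0|, 0 => //=; rewrite normr0.
have /bounded_funP/(_ 1)[M fM] :=
  @continuous_linear_bounded _ _ _ 0 f (@bop_continuous f 0).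
by exists M => _ [x /= x1 <-]; exact: fM.
Qed.

Lemma op_norm_ge0 (f : bounded_op X Y) : 0 <= op_norm f.
Proof.
apply: (@le_trans _ _ `|f 0|) => //.
by apply: (ub_le_sup (op_norm_has_sup f).2); exists 0 => //=; rewrite normr0.
Qed.

Lemma op_norm_le1 (f : bounded_op X Y) x : `|x| <= 1 -> `|f x| <= op_norm f.
Proof. by move=> x1; apply: (ub_le_sup (op_norm_has_sup f).2); exists x. Qed.

Lemma op_normP (f : bounded_op X Y) x : `|f x| <= op_norm f * `|x|.
Proof.
have [->|x0] := eqVneq x 0; first by rewrite linear0 !normr0 mulr0.
have nx0 : 0 < `|x| by rewrite normr_gt0.
rewrite -ler_pdivrMr//.
have -> : `|f x| / `|x| = `|f (`|x|^-1 *: x)|.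
  by rewrite linearZ normrZ normfV normr_id mulrC.
by apply: op_norm_le1; rewrite normrZ normfV normr_id mulVf// gt_eqF.
Qed.

Lemma op_norm_le (f : bounded_op X Y) (M : R) :
  (forall x, `|x| <= 1 -> `|f x| <= M) -> op_norm f <= M.
Proof.
move=> fM; apply: ge_sup; first exact: (op_norm_has_sup f).1.
by move=> _ [x /= x1 <-]; exact: fM.
Qed.

Lemma op_normD (f g : bounded_op X Y) :
  op_norm (f + g) <= op_norm f + op_norm g.
Proof.
apply: op_norm_le => x x1; rewrite bopD (le_trans (ler_normD _ _))//.
by rewrite lerD// op_norm_le1.
Qed.

Lemma op_normZ (a : R) (f : bounded_op X Y) :
  op_norm (a *: f) = `|a| * op_norm f.
Proof.
have le_ (b : R) (g : bounded_op X Y) : op_norm (b *: g) <= `|b| * op_norm g.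
  apply: op_norm_le => x x1; rewrite bopZ normrZ ler_wpM2l//.
  exact: op_norm_le1.
apply/eqP; rewrite eq_le le_/=.
have [->|a0] := eqVneq a 0; first by rewrite normr0 mul0r op_norm_ge0.
rewrite mulrC -ler_pdivlMr ?normr_gt0// mulrC -normfV.
by rewrite -{1}[f]scale1r -(mulVf a0) -scalerA le_.
Qed.

Lemma op_norm0_eq0 (f : bounded_op X Y) : op_norm f = 0 -> f = 0.
Proof.
move=> f0; apply: bop_ext => x; apply/eqP; rewrite bop0 -normr_le0.
by rewrite (le_trans (op_normP f x))// f0 mul0r.
Qed.

HB.instance Definition _ := Lmodule_isNormed.Build R (bounded_op X Y)
  op_normD op_normZ op_norm0_eq0.

Lemma bop_normE (f : bounded_op X Y) :
  `|f| = sup [set `|f x| | x in [set x : X | `|x| <= 1]].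
Proof. by []. Qed.

End Structure.

Lemma id_linear_continuous X : idfun \in @linear_continuous_fun X X.
Proof. by apply/linear_continuous_funP; split=> // x; exact: cvg_id. Qed.

Definition bop_id X : bounded_op X X := BoundedOp (@id_linear_continuous X).

Lemma comp_linear_continuous X Y Z (g : bounded_op Y Z) (f : bounded_op X Y) :
  g \o f \in @linear_continuous_fun X Z.
Proof.
apply/linear_continuous_funP; split=> [a x y|x]; first by rewrite /= !linearP.
by apply: continuous_comp; exact: bop_continuous.
Qed.

Definition bop_comp X Y Z (g : bounded_op Y Z) (f : bounded_op X Y) :
  bounded_op X Z := BoundedOp (comp_linear_continuous g f).

End BoundedLinearMaps.

Arguments bop_id {R} X.

Section Notions.
Context {R : realType} {X : completeNormedModType R}.
Implicit Types (T K : bounded_op X X) (A : set (bounded_op X X)).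

Definition dual (X : completeNormedModType R) := bounded_op X R^o.

Definition adjoint T (f : dual X) : dual X := bop_comp f T.

Definition compact_op K := precompact [set K x | x in [set x : X | `|x| <= 1]].

Definition essential_norm T : R :=
  inf [set `|T + K| | K in [set K | compact_op K]].

(* Positivity of the class of T in the Calkin algebra, whose norm is
   essential_norm. *)
Definition essentially_positive T :=
  exists2 h : R -> R^o, h =o_ (0^'+) (fun e : R => e : R^o) &
  \forall e \near 0^'+, essential_norm (bop_id X - e *: T) <= 1 + h e.

Definition essentially_real T := essentially_positive (bop_comp T T).

(* Not required to contain the identity nor to be closed. *)
Definition subalgebra A :=
  [/\ A 0,
      forall (a : R) S T, A S -> A T -> A (a *: S + T) &
      forall S T, A S -> A T -> A (bop_comp S T)].

Definition commuting A :=
  forall S T, A S -> A T -> bop_comp S T = bop_comp T S.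

Definition linear_subspace {V : lmodType R} (L : set V) :=
  L 0 /\ forall (a : R) u v, L u -> L v -> L (a *: u + v).

End Notions.

Definition infinite_dimensional {R : realType} (V : lmodType R) :=
  forall (n : nat) (v : 'I_n -> V),
    exists x : V, forall c : 'I_n -> R, x <> \sum_(i < n) c i *: v i.

(* Main.v *)
Require Import Defs.
From HB Require Import structures.
From mathcomp Require Import all_boot all_order all_algebra.
From mathcomp Require Import all_classical all_reals all_analysis.
From mathcomp Require Import finmap ring lra.
Set Implicit Arguments.
Unset Strict Implicit.
Unset Printing Implicit Defensive.
Import Order.TTheory GRing.Theory Num.Theory.
Import numFieldNormedType.Exports.
Local Open Scope classical_set_scope.
Local Open Scope ring_scope.

(* Suppose that [A] has no invariant subspace in the dual; then every orbit [A^* f], [f <> 0],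
   is dense. Fix a ball [B] of radius 1 around some [f0] of norm 2.

   If every [f] in [B] is moved close to [f0] by some [T] in [A] of small essential norm, weak*
   compactness reduces to finitely many such [T] (Lomonosov, Hilden) and yields backward orbits
   [g_k = S_k^* g_(k+1)] inside [B]. The functionals admitting a bounded backward orbit along
   [S_k] form an invariant subspace by commutativity, and an entropy count shows that it is
   not dense.

   Otherwise the closure [F] of [{T^* f : |T|_e < 1/8}] misses a neighbourhood of [f0] for some
   [f] in [B]. Essential reality gives [F - e W^* F <= (1 + o(e)) F] for sums of squares [W],
   so that at a drop point [y] of [F] the closed cone generated by the [(T^2)^* y] is proper. This
   cone is invariant under squares and, by extracting square roots, under [1 - e (V^2)^*]; hence at
   a nonzero drop point [z] of the cone it contains all small perturbations of [z] by differences
   of squares. By polarization and density of orbits these point in every direction, which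
   contradicts the choice of [z]. *)

(** * Hahn-Banach *)

Section HahnBanach.
Context {R : realType} {X : normedModType R}.
Implicit Types (p q : X -> R) (x y a : X).

Definition sublinear p :=
  (forall x y, p (x + y) <= p x + p y) /\
  (forall (t : R) x, 0 < t -> p (t *: x) = t * p x).

Lemma sublinearI p : (forall x y, p (x + y) <= p x + p y) ->
  (forall (t : R) x, 0 < t -> p (t *: x) <= t * p x) -> sublinear p.
Proof.
move=> pD pZ; split=> // t x t0; apply/eqP; rewrite eq_le pZ//=.
have tV : 0 < t^-1 by rewrite invr_gt0.
have := pZ t^-1 (t *: x) tV; rewrite scalerA mulVf ?gt_eqF// scale1r.
by rewrite -ler_pdivrMl// invrK.
Qed.

Lemma sublinear0 p : sublinear p -> p 0 = 0.
Proof.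
move=> [_ pZ]; have := pZ 2 0 (ltr0n _ 2); rewrite scaler0 => h; lra.
Qed.

Lemma sublinear_opp p x : sublinear p -> - p (- x) <= p x.
Proof.
move=> sp; have := sp.1 x (- x); rewrite subrr sublinear0// => h; lra.
Qed.

(** For sublinear [p], [shift_inf p a] is the largest sublinear minorant q of [p] with q(-a) <=
    -p(a), since q(x) <= q(x + t a) + t q(-a). *)
Definition shift_values p a x := [set p (x + t *: a) - t * p a | t in [set t | 0 <= t]].
Definition shift_inf p a x := inf (shift_values p a x).

Lemma shift_lb p a x : sublinear p -> lbound (shift_values p a x) (- p (- x)).
Proof.
move=> sp _ [t /= t0 <-]; rewrite lerBrDr.
have tpa : p (t *: a) = t * p a.
  have [->|tn0] := eqVneq t 0; first by rewrite scale0r mul0r sublinear0.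
  by apply: sp.2; rewrite lt_def tn0.
rewrite -tpa; have := sp.1 (- x) (x + t *: a); rewrite addKr => h; lra.
Qed.

Lemma shift_neq0 p a x : shift_values p a x !=set0.
Proof. by exists (p (x + 0 *: a) - 0 * p a), 0 => /=. Qed.

Lemma shift_has_inf p a x : sublinear p -> has_inf (shift_values p a x).
Proof. by move=> sp; split; [exact: shift_neq0|exists (- p (- x)); exact: shift_lb]. Qed.

Lemma shift_inf_le p a x t : sublinear p -> 0 <= t ->
  shift_inf p a x <= p (x + t *: a) - t * p a.
Proof. by move=> sp t0; apply: (ge_inf (shift_has_inf _ _ sp).2); exists t. Qed.

Lemma shift_inf_lt p a x e : sublinear p -> 0 < e ->
  exists2 t, 0 <= t & p (x + t *: a) - t * p a < shift_inf p a x + e.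
Proof.
move=> sp e0; have [_ [t /= t0 <-] h] := inf_adherent e0 (shift_has_inf a x sp).
by exists t.
Qed.

Lemma shift_sublinear p a : sublinear p -> sublinear (shift_inf p a).
Proof.
move=> sp; apply: sublinearI => [x y|s z s0].
  apply/ler_addgt0Pr => e e0.
  have e20 : 0 < e / 2 by rewrite divr_gt0.
  have [t t0 ht] := shift_inf_lt a x sp e20.
  have [s s0 hs] := shift_inf_lt a y sp e20.
  have := shift_inf_le a (x + y) sp (addr_ge0 t0 s0).
  rewrite scalerDl addrACA => h.
  have := sp.1 (x + t *: a) (y + s *: a) => h'; nra.
apply/ler_addgt0Pr => e e0.
  have [u u0 hu] := shift_inf_lt a z sp (divr_gt0 e0 s0).
  apply: le_trans (shift_inf_le a (s *: z) sp (mulr_ge0 (ltW s0) u0)) _.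
  rewrite -scalerA -scalerDr sp.2// -mulrA -mulrBr.
  by rewrite (le_trans (ler_wpM2l (ltW s0) (ltW hu)))// mulrDr mulrCA divff ?gt_eqF// mulr1.
Qed.

Lemma shift_le p a x : sublinear p -> shift_inf p a x <= p x.
Proof.
by move=> sp; have := shift_inf_le a x sp (lexx 0); rewrite scale0r addr0 mul0r subr0.
Qed.

(* A minimal sublinear [q] is additive: [shift_inf q a <= q] is again sublinear, and
   [shift_inf q a = q] gives [q x <= q (x + a) - q a]. *)
Lemma sublinear_above_linear p : sublinear p ->
  exists q, [/\ sublinear q, forall x, q x <= p x & forall x y, q (x + y) = q x + q y].
Proof.
move=> sp.
pose dom := (fun q : X -> R => sublinear q /\ forall x, q x <= p x).
pose T := {q | dom q}.
(* The order is reversed, so that a maximal element is a minimal sublinear functional below [p]. *)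
pose le (q r : T) := `[< forall x, sval r x <= sval q x >].
have [q qmin] : exists t : T, forall s, le t s -> s = t.
  apply: (@Zorn T le).
  - by move=> q; apply/asboolP.
  - move=> q r s /asboolP h /asboolP h'; apply/asboolP => x.
    exact: le_trans (h' x) (h x).
  - move=> [q qP] [r rP] /asboolP h /asboolP h'; apply: eq_exist => /=.
    by apply/funext => x; apply/eqP; rewrite eq_le (h' x) (h x).
  - move=> C totC; have [[c0 Cc0]|C0] := pselect (C !=set0); last first.
      exists (exist dom p (conj sp (fun=> lexx _))) => s Cs; exfalso; apply: C0.
      by exists s.
    pose V x := [set sval c x | c in C].
    have Vinf x : has_inf (V x).
      split; first by exists (sval c0 x), c0.
      exists (- p (- x)) => _ [c _ <-].
      apply: le_trans (sublinear_opp x (svalP c).1).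
      by rewrite lerN2; exact: (svalP c).2.
    have Vle x c : C c -> inf (V x) <= sval c x.
      by move=> Cc; apply: (ge_inf (Vinf x).2); exists c.
    have Vlt x e : 0 < e -> exists2 c, C c & sval c x < inf (V x) + e.
      by move=> e0; have [_ [c Cc <-] h] := inf_adherent e0 (Vinf x); exists c.
    (* Of two members of a chain the smaller one serves both terms of the subadditivity estimate. *)
    have sV : sublinear (fun x => inf (V x)).
      apply: sublinearI => [x y|s z s0].
        apply/ler_addgt0Pr => e e0.
        have e20 : 0 < e / 2 by rewrite divr_gt0.
        have [c Cc hc] := Vlt x _ e20; have [d Cd hd] := Vlt y _ e20.
        have [/asboolP cd|/asboolP dc] := totC _ _ Cc Cd.
          have := Vle (x + y) _ Cd; have := (svalP d).1.1 x y; have := cd x; lra.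
        have := Vle (x + y) _ Cc; have := (svalP c).1.1 x y; have := dc y; lra.
      apply/ler_addgt0Pr => e e0.
        have [c Cc hc] := Vlt z _ (divr_gt0 e0 s0).
        apply: le_trans (Vle (s *: z) _ Cc) _; rewrite (svalP c).1.2//.
        by rewrite (le_trans (ler_wpM2l (ltW s0) (ltW hc)))// mulrDr mulrCA divff ?gt_eqF// mulr1.
    have Vp x : inf (V x) <= p x by apply: le_trans (Vle x _ Cc0) ((svalP c0).2 x).
    by exists (exist dom _ (conj sV Vp)) => c Cc; apply/asboolP => x /=; exact: Vle.
exists (sval q); split; [exact: (svalP q).1|exact: (svalP q).2|move=> x a].
have sq := (svalP q).1.
apply/eqP; rewrite eq_le sq.1/=.
have sle y : shift_inf (sval q) a y <= p y.
  by apply: le_trans ((svalP q).2 y); exact: shift_le.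
pose r : T := exist dom _ (conj (shift_sublinear a sq) sle).
have /(congr1 sval)/= rq : r = q by apply: qmin; apply/asboolP => y /=; exact: shift_le.
have := shift_inf_le a x sq ler01.
rewrite {1}rq scale1r mul1r; lra.
Qed.

Lemma norm_sublinear : sublinear (fun x : X => `|x|).
Proof.
split=> [x y|t x t0]; first exact: ler_normD.
by rewrite normrZ gtr0_norm.
Qed.

Lemma additive_dominated_continuous q : (forall x y, q (x + y) = q x + q y) ->
  sublinear q -> (forall x, q x <= `|x|) -> (q : X -> R^o) \in @linear_continuous_fun R X R^o.
Proof.
move=> qD sq qle; apply/linear_continuous_funP.
have qN x : q (- x) = - q x.
  have := qD x (- x); rewrite subrr sublinear0// => h; lra.
have qZ (t : R) x : q (t *: x) = t * q x.
  have [t0|t0|->] := ltgtP t 0; last by rewrite scale0r mul0r sublinear0.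
    have := sq.2 (- t) x; rewrite oppr_gt0 => /(_ t0).
    by rewrite scaleNr qN mulNr => /oppr_inj.
  exact: sq.2.
have ql : linear (q : X -> R^o) by move=> t x y; rewrite qD qZ.
split=> //.
pose f := HB.pack_for {linear X -> R^o} (q : X -> R^o)
  (GRing.isLinear.Build R X R^o *:%R q ql).
apply: (@bounded_linear_continuous _ _ _ f).
apply/linear_boundedP; near=> M => x; rewrite /=.
have M1 : 1 <= M by near: M; exact: nbhs_pinfty_ge.
apply: le_trans (_ : `|x| <= _).
  by rewrite ler_norml qle andbT lerNl -qN (le_trans (qle _))// normrN.
by rewrite ler_peMl.
Unshelve. all: by end_near.
Qed.

(** The norm shifted in the direction [x] is at most -|x| at -x, so an additive functional below it
    is at least |x| at [x]. *)
Lemma dual_separates x : x != 0 -> exists f : bounded_op X R^o, f x != 0.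
Proof.
move=> x0.
have snorm := norm_sublinear.
have [q [sq qle qD]] := sublinear_above_linear (shift_sublinear x snorm).
have qn y : q y <= `|y| by apply: le_trans (qle y) _; exact: shift_le.
have qcont := additive_dominated_continuous qD sq qn.
exists (BoundedOp qcont) => /=.
have h := qle (- x).
have := shift_inf_le x (- x) snorm ler01.
rewrite scale1r addNr normr0 mul1r sub0r => h'.
have := qD x (- x); rewrite subrr sublinear0// => h''.
have nx : 0 < `|x| by rewrite normr_gt0.
apply/eqP => qx0; lra.
Qed.

End HahnBanach.

(** * Ultrafilters, norm closures and composition of bounded operators *)

Lemma fmap_ultra (S T : Type) (f : S -> T) (F : set_system S) :
  UltraFilter F -> UltraFilter (f @ F).
Proof.
move=> FU; split=> [|G GP FG]; first exact: fmap_proper_filter.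
apply/seteqP; split=> [B GB|]; last exact: FG.
have [//|FnB] := in_ultra_setVsetC (f @^-1` B) FU.
have /FG GnB : (f @ F) (~` B) by [].
by case: (@filter_not_empty _ G _); rewrite -(setICr B); exact: filterI.
Qed.

Section NormedClosure.
Context {R : realType} {V : normedModType R}.

Lemma closure_normP (S : set V) (p : V) :
  closure S p <-> forall e : R, 0 < e -> exists2 s, S s & `|s - p| < e.
Proof.
split=> [Sp e e0|Sp B /nbhs_normP[e /= e0 eB]].
  have [s [Ss /= ps]] := Sp _ (nbhsx_ballx p e e0).
  by exists s => //; rewrite -ball_normE /= distrC in ps.
have [s Ss sp] := Sp _ e0; exists s; split => //.
by apply: eB; rewrite /= distrC.
Qed.

Lemma closure_map (S S' : set V) (p : V) (phi : V -> V) (c : R) :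
  (forall u v, `|phi u - phi v| <= c * `|u - v|) ->
  (forall s, S s -> closure S' (phi s)) -> closure S p -> closure S' (phi p).
Proof.
move=> lip Sphi /closure_normP Sp; apply/closure_normP => e e0.
have c0 : 0 < `|c| + 1 by rewrite ltr_pwDr.
have e20 : 0 < e / 2 by rewrite divr_gt0.
have [s Ss sp] := Sp _ (divr_gt0 e20 c0).
have /closure_normP/(_ _ e20)[s' Ss' ss'] := Sphi _ Ss.
exists s' => //; apply: le_lt_trans (ler_distD (phi s) _ _) _.
rewrite (splitr e); apply: ltrD => //.
apply: le_lt_trans (lip _ _) _; apply: le_lt_trans (_ : (`|c| + 1) * `|s - p| < _).
  by rewrite ler_wpM2r// (le_trans (ler_norm c))// lerDl.
by rewrite mulrC -ltr_pdivlMr.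
Qed.

Lemma closure_linear_subspace (S : set V) :
  linear_subspace S -> linear_subspace (closure S).
Proof.
move=> [S0 SD]; split=> [|a u v /closure_normP Su /closure_normP Sv].
  exact: subset_closure.
apply/closure_normP => e e0.
have a0 : 0 < `|a| + 1 by rewrite ltr_pwDr.
have e20 : 0 < e / 2 by rewrite divr_gt0.
have [s Ss su] := Su _ (divr_gt0 e20 a0).
have [t St tv] := Sv _ e20.
exists (a *: s + t); first exact: SD.
rewrite opprD addrACA -scalerBr (le_lt_trans (ler_normD _ _))// (splitr e).
rewrite ltr_leD ?(ltW tv)// normrZ.
apply: le_lt_trans (_ : (`|a| + 1) * `|s - u| < _).
  by rewrite ler_wpM2r// lerDl.
by rewrite mulrC -ltr_pdivlMr.
Qed.

End NormedClosure.

Section OperatorCalculus.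
Context {R : realType}.

Lemma bop_comp_norm (X Y Z : normedModType R) (g : bounded_op Y Z) (f : bounded_op X Y) :
  `|bop_comp g f| <= `|g| * `|f|.
Proof.
apply: op_norm_le => x x1 /=; rewrite (le_trans (op_normP _ _))//.
by rewrite ler_wpM2l ?op_norm_ge0//; exact: op_norm_le1.
Qed.

Lemma bop_compDl (X Y Z : normedModType R) (S T : bounded_op Y Z) (U : bounded_op X Y) :
  bop_comp (S + T) U = bop_comp S U + bop_comp T U.
Proof. by apply: bop_ext. Qed.

Lemma bop_compZl (X Y Z : normedModType R) a (S : bounded_op Y Z) (U : bounded_op X Y) :
  bop_comp (a *: S) U = a *: bop_comp S U.
Proof. by apply: bop_ext. Qed.

Lemma bop_compDr (X Y Z : normedModType R) (S : bounded_op Y Z) (U V : bounded_op X Y) :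
  bop_comp S (U + V) = bop_comp S U + bop_comp S V.
Proof. by apply: bop_ext => x; rewrite bopD /= linearD. Qed.

Lemma bop_compZr (X Y Z : normedModType R) a (S : bounded_op Y Z) (U : bounded_op X Y) :
  bop_comp S (a *: U) = a *: bop_comp S U.
Proof. by apply: bop_ext => x; rewrite bopZ /= linearZ. Qed.

Lemma bop_compA (X Y Z W : normedModType R) (S : bounded_op Z W) (T : bounded_op Y Z)
  (U : bounded_op X Y) : bop_comp S (bop_comp T U) = bop_comp (bop_comp S T) U.
Proof. by apply: bop_ext. Qed.

End OperatorCalculus.

(** * The dual space and weak* compactness *)

Section Dual.
Context {R : realType} {X : completeNormedModType R}.
Implicit Types (f g : dual X) (S T : bounded_op X X).

Lemma adjoint_linear T : linear (adjoint T).
Proof. by move=> a f g; apply: bop_ext. Qed.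
HB.instance Definition _ T :=
  GRing.isLinear.Build R (dual X) (dual X) *:%R (adjoint T) (adjoint_linear T).

Lemma adjointE T f x : adjoint T f x = f (T x). Proof. by []. Qed.

Lemma adjoint_addl S T f : adjoint (S + T) f = adjoint S f + adjoint T f.
Proof. by apply: bop_ext => x; rewrite /adjoint /= linearD. Qed.

Lemma adjoint_scalel a T f : adjoint (a *: T) f = a *: adjoint T f.
Proof. by apply: bop_ext => x; rewrite /adjoint /= linearZ. Qed.

Lemma adjoint_oppl T f : adjoint (- T) f = - adjoint T f.
Proof. by rewrite -scaleN1r adjoint_scalel scaleN1r. Qed.

Lemma adjoint0l f : adjoint 0 f = 0.
Proof. by rewrite -(scale0r (0 : bounded_op X X)) adjoint_scalel scale0r. Qed.

Lemma adjoint_id f : adjoint (bop_id X) f = f.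
Proof. exact: bop_ext. Qed.

Lemma adjoint_comp S T f : adjoint (bop_comp S T) f = adjoint T (adjoint S f).
Proof. exact: bop_ext. Qed.

Lemma adjoint_norm T f : `|adjoint T f| <= `|T| * `|f|.
Proof. by rewrite mulrC; exact: bop_comp_norm. Qed.

Lemma adjoint_lip T f g : `|adjoint T f - adjoint T g| <= `|T| * `|f - g|.
Proof. by rewrite -linearB; exact: adjoint_norm. Qed.

(** Weak* convergence is handled as pointwise convergence along a filter; the bound |f_i x| <= C|x|
    survives and makes the limit continuous. *)
Lemma pointwise_limit (I : Type) (F : set_system I) {FF : ProperFilter F}
    (f : I -> dual X) (l : X -> R) (C : R) :
  (forall x, f i x @[i --> F] --> l x) -> (\forall i \near F, `|f i| <= C) ->
  exists g, forall x, g x = l x.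
Proof.
move=> fl fC.
have lle x : `|l x| <= C * `|x|.
  have h : `|f i x : R| @[i --> F] --> `|l x| by apply: cvg_norm; exact: fl.
  apply: cvgr_to_le h _; apply: filterS fC => i fiC.
  by rewrite (le_trans (op_normP (f i) x))// ler_wpM2r.
have llin : linear (l : X -> R^o).
  move=> a x y; apply: (cvg_unique _ (fl (a *: x + y))); first exact: norm_hausdorff.
  have -> : (fun i => f i (a *: x + y)) = (fun i => a *: (f i x : R^o) + f i y).
    by apply/funext => i; rewrite linearP.
  by apply: cvgD; [apply: cvgZl_tmp|]; exact: fl.
have lc : l \in @linear_continuous_fun R X R^o.
  apply/linear_continuous_funP; split=> //.
  pose l' := HB.pack_for {linear X -> R^o} (l : X -> R^o)
    (GRing.isLinear.Build R X R^o *:%R l llin).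
  apply: (@bounded_linear_continuous _ _ _ l').
  apply/linear_boundedP; near=> M => x.
  by rewrite (le_trans (lle x))// ler_wpM2r//; near: M; exact: nbhs_pinfty_ge.
by exists (BoundedOp lc).
Unshelve. all: by end_near.
Qed.

(** Closed balls are weak* closed. *)
Lemma pointwise_limit_ball (I : Type) (F : set_system I) {FF : ProperFilter F}
    (f : I -> dual X) (a g : dual X) (r : R) :
  (forall x, f i x @[i --> F] --> g x) -> (\forall i \near F, `|f i - a| <= r) ->
  `|g - a| <= r.
Proof.
move=> fg far; apply: op_norm_le => x x1.
have h : `|(f i - a) x : R| @[i --> F] --> `|(g - a) x : R|.
  apply: cvg_norm; rewrite bopD bopN; apply: cvgD; first exact: fg.
  exact: cvg_cst.
apply: cvgr_to_le h _; apply: filterS far => i fir.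
by rewrite (le_trans (op_norm_le1 _ x1)).
Qed.

(** Banach-Alaoglu in ultrafilter form: the values at [x] eventually lie in the compact segment
    [-C|x|, C|x|]. *)
Lemma ultra_pointwise_limit (I : Type) (F : set_system I) {FF : UltraFilter F}
    (f : I -> dual X) (C : R) : (\forall i \near F, `|f i| <= C) ->
  exists g, forall x, f i x @[i --> F] --> g x.
Proof.
move=> fC.
have lim x : exists l : R, f i x @[i --> F] --> l.
  have := @segment_compact R (- (C * `|x|)) (C * `|x|).
  rewrite compact_ultra => /(_ (f i x @[i --> F]) (fmap_ultra _ _)) [].
    apply: (@filterS _ F _ _ _ _ fC) => i fiC.
    rewrite /= in_itv /= -ler_norml.
    by rewrite (le_trans (op_normP (f i) x))// ler_wpM2r.
  by move=> l [_ hl]; exists l.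
have [l hl] := choice lim.
have [g gl] := pointwise_limit hl fC.
by exists g => x; rewrite gl.
Qed.

(** The limit is built pointwise; weak* closedness of balls upgrades it to a norm limit.
    Completeness lets the variational principle run in the dual. *)
Lemma dual_complete (F : set_system (bounded_op X R^o)) :
  ProperFilter F -> cauchy F -> cvg F.
Proof.
move=> FF /cauchyP/= cF.
have near1 (e : R) : 0 < e -> exists h : dual X, \forall f \near F, `|f - h| <= e.
  move=> e0; have [h hF] := cF e e0; exists h; apply: filterS hF => f.
  by rewrite -ball_normE /= distrC => /ltW.
have lim x : exists l : R, (f : dual X) x @[f --> F] --> l.
  suff /cvg_ex : cvg ((f : dual X) x @[f --> F]) by [].
  apply: cauchy_cvg; apply/cauchyP => e e0.
  have d0 : 0 < e / (`|x| + 1) by rewrite divr_gt0// ltr_pwDr.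
  have [h hF] := cF _ d0; exists (h x); apply: (@filterS _ F _ _ _ _ hF) => f.
  rewrite -!ball_normE /= => hf.
  have -> : h x - f x = (h - f) x by [].
  rewrite (le_lt_trans (op_normP _ _))//.
  rewrite (le_lt_trans (_ : _ <= `|h - f| * (`|x| + 1)))//.
    by rewrite ler_wpM2l ?op_norm_ge0// lerDl.
  by rewrite -ltr_pdivlMr// ltr_pwDr.
have [l hl] := choice lim.
have [h hF] := near1 1 ltr01.
have [|g gl] := pointwise_limit (F := F) (C := 1 + `|h|) hl.
  apply: filterS hF => f; rewrite -{2}[f](subrK h) => fh.
  by rewrite (le_trans (ler_normD _ _))// lerD2r.
have hg x : (f : dual X) x @[f --> F] --> g x by rewrite gl.
apply/cvg_ex; exists g; apply/cvgrPdist_le => e e0.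
have [k kF] := near1 _ (divr_gt0 e0 (ltr0n R 2)).
have gk := pointwise_limit_ball hg kF.
apply: filterS kF => f fk; apply: le_trans (ler_distD k g f) _.
by rewrite (splitr e); apply: lerD; [exact: gk|rewrite distrC; exact: fk].
Qed.

End Dual.
HB.instance Definition _ (R : realType) (X : completeNormedModType R) :=
  Uniform_isComplete.Build (bounded_op X R^o) (@dual_complete R X).

(** * Variational principle *)

Section Ekeland.
Context {R : realType} {E : completeNormedModType R}.

(** Ekeland's principle for the distance phi to [u]. Almost minimising phi, up to 2^-n, over the set
    [S (x n)] of points below [x n] for the order |z - x| <= 3 (phi x - phi z) gives a Cauchy
    sequence with minimal limit. *)
Lemma ekeland_norm (F : set E) (u c : E) : closed F -> F c ->
  exists y, [/\ F y, `|y - u| <= `|c - u| &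
    forall z, F z -> `|z - y| <= 3 * (`|y - u| - `|z - u|) -> z = y].
Proof.
move=> cF Fc.
pose phi x := `|x - u|.
pose S x := [set z | F z /\ `|z - x| <= 3 * (phi x - phi z)].
have Sx x : F x -> S x x by move=> Fx; split; rewrite // !subrr normr0 mulr0.
have Strans x y z : S x y -> S y z -> S x z.
  move=> [Fy xy] [Fz yz]; split=> //.
  have := ler_distD y z x; lra.
have phi_has_inf x : F x -> has_inf [set phi z | z in S x].
  move=> Fx; split; first by exists (phi x), x => //; exact: Sx.
  by exists 0 => _ [z _ <-]; exact: normr_ge0.
have step (p : nat * E) : exists z, F p.2 ->
    S p.2 z /\ forall w, S p.2 w -> phi z <= phi w + (2^-1) ^+ p.1.
  have [Fx|nFx] := pselect (F p.2); last by exists p.2.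
  have e0 : (0 : R) < 2^-1 ^+ p.1 by rewrite exprn_gt0.
  have [_ [z Sz <-] hz] := inf_adherent e0 (phi_has_inf _ Fx).
  exists z => _; split=> // w Sw; rewrite (le_trans (ltW hz))// lerD2r.
  by apply: (ge_inf (phi_has_inf _ Fx).2); exists w.
have [g gP] := choice step.
pose x := fix x n := if n is m.+1 then g (m, x m) else c.
have xF n : F (x n).
  by elim: n => //= n IH; exact: (gP (n, x n) IH).1.1.
have xS n k : S (x n) (x (n + k)%N).
  elim: k => [|k IH]; first by rewrite addn0; exact: Sx.
  by rewrite addnS; apply: Strans IH (gP (_, x (n + k)%N) (xF _)).1.
have xinf n w : S (x n) w -> phi (x n.+1) <= phi w + 2^-1 ^+ n.
  exact: (gP (n, x n) (xF n)).2.
have xle n k : `|x (n.+1 + k)%N - x n.+1| <= 3 * 2^-1 ^+ n.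
  have [_ h1] := xS n.+1 k.
  have h2 : S (x n) (x (n.+1 + k)%N) by rewrite addSnnS; exact: xS.
  have := xinf _ _ h2; lra.
have small (e : R) : 0 < e -> exists n, 3 * (2^-1 : R) ^+ n <= e.
  move=> e0; have h1 : `|2^-1 : R| < 1 by rewrite ger0_norm ?invr_ge0// invf_lt1// ltr1n.
  have /cvgrPdist_le/(_ _ (divr_gt0 e0 (ltr0n R 3)))[n _ /(_ n (leqnn _))/=] := cvg_expr h1.
  rewrite sub0r normrN ger0_norm ?exprn_ge0// => h.
  by exists n; rewrite mulrC -ler_pdivlMr.
have xcvg : cvg (x n @[n --> \oo]).
  apply: cauchy_cvg; apply/cauchyP => e e0.
  have [n hn] := small _ (divr_gt0 e0 (ltr0n R 2)).
  exists (x n.+1); exists n.+1 => // m /= nm.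
  rewrite -ball_normE /= distrC -(subnKC nm).
  apply: le_lt_trans (xle n _) _; apply: le_lt_trans hn _.
  by rewrite ltr_pdivrMr// mulr_natr mulr2n ltrDl.
have /cvg_ex[y xy] := xcvg.
have phic : phi (x n) @[n --> \oo] --> phi y.
  by apply: cvg_norm; apply: cvgB => //; exact: cvg_cst.
have Fy : F y by apply: (closed_cvg F cF _ _ xy); near=> n; exact: xF.
have phiy n : phi y <= phi (x n).
  apply: cvgr_to_le phic _; exists n => // m /= nm; rewrite -(subnKC nm).
  by have [_] := xS n (m - n)%N; have := normr_ge0 (x (n + (m - n))%N - x n); lra.
have Sy n : S (x n) y.
  split=> //.
  have h : `|x m - x n| + 3 * phi (x m) @[m --> \oo] --> `|y - x n| + 3 * phi y.
    apply: cvgD; first by apply: cvg_norm; apply: cvgB => //; exact: cvg_cst.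
    by apply: cvgM => //; exact: cvg_cst.
  have : `|y - x n| + 3 * phi y <= 3 * phi (x n).
    apply: cvgr_to_le h _; exists n => // m /= nm; rewrite -(subnKC nm).
    by have [_] := xS n (m - n)%N; lra.
  lra.
exists y; split=> //; first exact: (phiy 0).
move=> z Fz zy; apply/eqP; rewrite -subr_eq0 -normr_le0.
apply: (le_trans zy).
suff : phi y <= phi z by rewrite /phi; lra.
apply/ler_addgt0Pr => e e0; have [n hn] := small e e0.
have := xinf n z (Strans _ _ _ (Sy n) (conj Fz zy)); have := phiy n.+1.
have : (0 : R) <= 2^-1 ^+ n by rewrite exprn_ge0.
lra.
Unshelve. all: by end_near.
Qed.

(* A weak form of Danes' drop theorem. *)
Lemma drop_point (F : set E) (u c : E) : closed F -> F c -> ~ F u ->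
  exists y, [/\ F y, `|y - u| <= `|c - u|, 0 < `|y - u| &
    forall b (t : R), `|b - u| <= `|y - u| / 2 -> 0 < t -> t <= 1 ->
      ~ F (y + t *: (b - y))].
Proof.
move=> cF Fc nFu; have [y [Fy yc ymin]] := ekeland_norm u cF Fc.
have d0 : 0 < `|y - u|.
  by rewrite normr_gt0 subr_eq0; apply/eqP => yu; apply: nFu; rewrite -yu.
exists y; split=> // b t bu t0 t1 Fz.
have by0 : b - y = 0.
  apply: (scalerI (lt0r_neq0 t0)); rewrite scaler0.
  have -> : t *: (b - y) = y + t *: (b - y) - y by rewrite [RHS]addrC addKr.
  apply/eqP; rewrite subr_eq0; apply/eqP; apply: ymin => //.
  rewrite addrAC subrr add0r normrZ gtr0_norm//.
  (* With d = |y - u| and z the point of the segment, |z - y| <= 3 t d / 2 while d - |z - u| >= t d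
     / 2; hence the factor 3 in [ekeland_norm]. *)
  have h1 : `|b - y| <= `|b - u| + `|y - u| by rewrite (distrC y) ler_distD.
  have h2 : `|y + t *: (b - y) - u| <= (1 - t) * `|y - u| + t * `|b - u|.
    have -> : y + t *: (b - y) - u = (1 - t) *: (y - u) + t *: (b - u).
      have -> : b - y = (b - u) - (y - u) by rewrite opprB addrA subrK.
      rewrite scalerBr scalerBl scale1r addrAC -[RHS]addrA.
      by rewrite [in RHS](addrC (- _)).
    rewrite (le_trans (ler_normD _ _))// !normrZ (gtr0_norm t0) ger0_norm//.
    by rewrite subr_ge0.
  nra.
move/eqP: by0; rewrite subr_eq0 => /eqP by0; rewrite by0 in bu.
by move: bu; lra.
Qed.

End Ekeland.

(** * Operators of small essential norm and their backward orbits *)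

Section Nets.
Context {R : realType} {X : completeNormedModType R}.
Implicit Types (f g : dual X) (S T K : bounded_op X X).

Lemma compact_op_net K (e : R) : compact_op K -> 0 < e ->
  exists s : seq X, forall x, `|x| <= 1 -> exists2 y, y \in s & `|K x - y| <= e.
Proof.
rewrite /compact_op precompactE compact_cover => cK e0.
have [] := cK X setT (fun y => ball y e).
- by move=> y _; exact: ball_open.
- by move=> y _; exists y => //; exact: ballxx.
move=> D _ KD; exists (enum_fset D) => x x1.
have [|y Dy] := KD (K x); first by apply: subset_closure; exists x.
rewrite -ball_normE /= => yx; exists y; first exact: Dy.
by rewrite distrC ltW.
Qed.

Lemma compact_op0 : compact_op (0 : bounded_op X X).
Proof.
apply: (@precompact_subset _ _ [set 0]) => [_ [x _ <-]|]; first by [].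
apply: compact_precompact; first exact: norm_hausdorff.
exact: compact_set1.
Qed.

Lemma essential_norm_has_inf T : has_inf [set `|T + K| | K in [set K | compact_op K]].
Proof.
split; first by exists `|T + 0|, 0 => //; exact: compact_op0.
by exists 0 => _ [K _ <-]; exact: normr_ge0.
Qed.

Lemma essential_norm_lt T (d : R) : essential_norm T < d ->
  exists2 K, compact_op K & `|T + K| < d.
Proof.
rewrite -subr_gt0 => d0.
have [_ [K cK <-] h] := inf_adherent d0 (essential_norm_has_inf T).
by exists K => //; move: h; rewrite -/(essential_norm T) subrKC.
Qed.

Lemma essential_norm_le T K : compact_op K -> essential_norm T <= `|T + K|.
Proof. by move=> cK; apply: (ge_inf (essential_norm_has_inf T).2); exists K. Qed.

(** Write T = (T + K) - K with |T + K| < 1/8 and take a 1/12-net for the image of the unit ball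
    under [K]: the errors 2/8, 2/12 and 1/12 add up to 1/2. *)
Lemma adjoint_net T : essential_norm T < 8^-1 ->
  exists ys : seq X, forall g, `|g| <= 2 -> (forall y, y \in ys -> `|g y : R| <= 12^-1) ->
    `|adjoint T g| <= 2^-1.
Proof.
move=> /essential_norm_lt[K cK TK].
have e0 : (0 : R) < 12^-1 by rewrite invr_gt0.
have [ys ysP] := compact_op_net cK e0.
exists ys => g g2 gys; apply: op_norm_le => x x1.
have [y yys Kxy] := ysP x x1.
have h1 : `|g ((T + K) x) : R| <= 2 * 8^-1.
  apply: le_trans (op_normP g _) _; apply: ler_pM => //; first exact: op_norm_ge0.
  by apply: le_trans (op_norm_le1 (T + K) x1) _; exact: ltW.
have h2 : `|g (K x - y) : R| <= 2 * 12^-1.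
  by apply: le_trans (op_normP g _) _; apply: ler_pM => //; exact: op_norm_ge0.
have h3 := gys _ yys.
have -> : (adjoint T g x : R) = g ((T + K) x) - (g (K x - y) + g y).
  by rewrite bopD linearD /= linearB /= subrK addrK.
apply: le_trans (ler_normB _ _) _.
apply: le_trans (lerD h1 (le_trans (ler_normD _ _) (lerD h2 h3))) _.
lra.
Qed.

(** Total boundedness of the dual unit ball for finitely many evaluations, phrased as a colouring by
    cells of width [e] for later pigeonhole counting. *)
Lemma dual_coloring (ys : seq X) (e : R) : 0 < e ->
  exists (Q : finType) (col : dual X -> Q), forall g h, `|g| <= 1 -> `|h| <= 1 ->
    col g = col h -> forall y, y \in ys -> `|g y - h y : R| <= e.
Proof.
move=> e0; elim: ys => [|y ys [Q [col colP]]].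
  by exists unit, (fun=> tt).
(* On the unit ball, adding |y| moves the value into [0, 2|y|], so the cell number is at most
   [N]. *)
pose cell g := Num.truncn ((g y + `|y|) / e).
pose N := Num.truncn (2 * `|y| / e).
exists (Q * 'I_N.+1)%type, (fun g => (col g, inord (cell g))).
have gy g : `|g| <= 1 -> 0 <= (g y + `|y| : R) <= 2 * `|y|.
  move=> g1; have : `|g y : R| <= `|y|.
    by apply: le_trans (op_normP g y) _; rewrite ler_piMl.
  by rewrite ler_norml => /andP[]; lra.
have celllt g : `|g| <= 1 -> (cell g < N.+1)%N.
  move=> /gy /andP[_ gy2]; rewrite ltnS; apply: le_truncn.
  by rewrite ler_pM2r// invr_gt0.
have cellP g : `|g| <= 1 -> (cell g)%:R * e <= (g y + `|y| : R) < ((cell g).+1)%:R * e.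
  move=> /gy /andP[gy0 _]; rewrite -ler_pdivlMr// -ltr_pdivrMr//.
  by apply: truncn_itv; rewrite divr_ge0// ltW.
move=> g h g1 h1 [colgh /(congr1 val)/=]; rewrite !inordK ?celllt// => cellgh z.
rewrite inE => /orP[/eqP->|]; last exact: colP.
have /andP[] := cellP _ g1; have /andP[] := cellP _ h1; rewrite cellgh -natr1.
set c := _%:R => a1 a2 a3 a4; rewrite ler_norml; apply/andP; split; lra.
Qed.

Lemma adjoint_coloring (Ts : seq (bounded_op X X)) :
  (forall T, T \in Ts -> essential_norm T < 8^-1) ->
  exists (Q : finType) (col : dual X -> Q), forall g h, `|g| <= 1 -> `|h| <= 1 ->
    col g = col h -> forall T, T \in Ts -> `|adjoint T (g - h)| <= 2^-1.
Proof.
move=> TsP.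
have [ys ysP] : exists ys : seq X, forall T, T \in Ts -> forall g, `|g| <= 2 ->
    (forall y, y \in ys -> `|g y : R| <= 12^-1) -> `|adjoint T g| <= 2^-1.
  elim: Ts TsP => [|T Ts IH] TsP; first by exists [::].
  have [|ys ysP] := IH; first by move=> S STs; apply: TsP; rewrite inE STs orbT.
  have [|zs zsP] := @adjoint_net T; first by apply: TsP; rewrite inE eqxx.
  exists (zs ++ ys) => S; rewrite inE => /orP[/eqP->|STs] g g2 gy.
    by apply: zsP => // y yz; apply: gy; rewrite mem_cat yz.
  by apply: (ysP S) => // y yz; apply: gy; rewrite mem_cat yz orbT.
have [Q [col colP]] := @dual_coloring ys 12^-1 ltac:(by rewrite invr_gt0).
exists Q, col => g h g1 h1 cgh T TTs; apply: (ysP T) => //; last exact: colP.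
by apply: le_trans (ler_normB _ _) _; apply: le_trans (lerD g1 h1) _.
Qed.

End Nets.

(** * Entropy count for backward orbits *)

Section Entropy.

Lemma pigeonhole_class (I Q : finType) (c : I -> Q) (A : {set I}) (m : nat) :
  (#|Q| * m < #|A|)%N -> exists q, (m < #|[set i in A | c i == q]|)%N.
Proof.
move=> hA; apply: contrapT => /forallNP h; move: hA; apply/negP; rewrite -leqNgt.
rewrite -sum1_card (partition_big c predT)//= -sum_nat_const.
apply: leq_sum => q _; rewrite sum1dep_card.
by move: (h q) => /negP; rewrite -leqNgt.
Qed.

Context {R : realType} {X : completeNormedModType R}.
Variables (S : nat -> bounded_op X X) (Q : finType) (col : dual X -> Q).
Hypothesis colP : forall g h, `|g| <= 1 -> `|h| <= 1 -> col g = col h ->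
  forall k, `|adjoint (S k) (g - h)| <= 2^-1.

(** At each level some colour class keeps at least a share 1/|Q| of the indices, and functionals of
    one colour come twice as close when pulled back one step. *)
Lemma orbit_collision (I : finType) (h : I -> nat -> dual X)
    (hS : forall i k, h i k = adjoint (S k) (h i k.+1)) k (A : {set I}) (d : R) :
  0 < d -> (#|Q| ^ k < #|A|)%N ->
  (forall i j, i \in A -> j \in A -> `|h i k - h j k| <= d) ->
  exists i j, i != j /\ `|h i 0%N - h j 0%N| <= d / 2 ^+ k.
Proof.
elim: k A d => [|k IH] A d d0 hA hd.
  move: hA; rewrite expn0 => /card_gt1P[i [j [iA jA ij]]].
  by exists i, j; split=> //; rewrite expr0 divr1; exact: hd.
have [i0 i0A] : exists i0, i0 \in A.
  by apply/set0Pn; rewrite -card_gt0 (leq_trans _ hA).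
(* Differences with a fixed member are rescaled into the unit ball, where [colP] applies. *)
pose g i := d^-1 *: (h i k.+1 - h i0 k.+1).
have g1 i : i \in A -> `|g i| <= 1.
  move=> iA; rewrite normrZ gtr0_norm ?invr_gt0// ler_pdivrMl// mulr1.
  exact: hd.
rewrite expnS in hA.
have [q hq] := pigeonhole_class (fun i => col (g i)) hA.
have [i j|i [j [ij hij]]] := IH _ (d / 2) (divr_gt0 d0 (ltr0n _ 2)) hq.
  rewrite !inE => /andP[iA /eqP ci] /andP[jA /eqP cj].
  rewrite (hS i k) (hS j k) -linearB.
  have -> : h i k.+1 - h j k.+1 = d *: (g i - g j).
    rewrite -scalerBr scalerA divff ?gt_eqF// scale1r.
    by rewrite opprB addrA subrK.
  rewrite linearZ normrZ gtr0_norm// ler_pM2l//.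
  by apply: colP; [exact: g1|exact: g1|rewrite ci cj].
exists i, j; split=> //; apply: le_trans hij _.
by rewrite -mulrA -invfM -exprS.
Qed.

End Entropy.

Section BackwardOrbits.
Context {R : realType} {X : completeNormedModType R}.
Implicit Types (S : nat -> bounded_op X X).

(** By induction: a vector outside the span is corrected to be killed by the earlier [g],
    Hahn-Banach gives a functional equal to 1 on it, and this is corrected to vanish on the earlier
    [x]. *)
Lemma biorthogonal_system (n : nat) : infinite_dimensional X ->
  exists (x : nat -> X) (g : nat -> dual X), forall i j, (i < n)%N -> (j < n)%N ->
    (g i (x j) : R) = (i == j)%:R.
Proof.
move=> infX; elim: n => [|n [x [g gx]]]; first by exists (fun=> 0), (fun=> 0).
have [z zP] := infX n (fun i => x i).
pose z' := z - \sum_(i < n) (g i z : R) *: x i.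
have z'0 : z' != 0.
  rewrite subr_eq0; apply/eqP; exact: (zP (fun i => g i z)).
have gz' i : (i < n)%N -> (g i z' : R) = 0.
  move=> i_n; rewrite /z' linearB linear_sum /= (bigD1 (Ordinal i_n))//= big1.
    by rewrite linearZ /= gx// eqxx addr0 /GRing.scale/= mulr1 subrr.
  move=> j /eqP ji; rewrite linearZ /= gx//.
  case: eqP => [e|_]; last by rewrite /GRing.scale/= mulr0.
  by exfalso; apply: ji; apply: val_inj.
have [h0 h0z] := dual_separates z'0.
pose h : dual X := (h0 z' : R)^-1 *: (h0 : dual X).
have hz : (h z' : R) = 1 by rewrite /h bopZ /GRing.scale/= mulVf.
pose k : dual X := h - \sum_(i < n) (h (x i) : R) *: g i.
have sumE (c : 'I_n -> R) w :
    ((\sum_(i < n) c i *: g i : dual X) w : R) = \sum_(i < n) c i * (g i w : R).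
  by elim/big_ind2: _ => // [u a v b <- <-]; rewrite bopD.
exists (fun j => if (j == n)%N then z' else x j), (fun i => if (i == n)%N then k else g i).
have kE w : (k w : R) = (h w : R) - \sum_(i < n) (h (x i) : R) * (g i w : R).
  by rewrite /k bopD bopN sumE.
move=> i j; rewrite !ltnS.
case: (eqVneq i n) => [->|i_n]; case: (eqVneq j n) => [->|j_n] ile jle.
- by rewrite kE hz big1 ?subr0// => l _; rewrite gz'// mulr0.
- have jn : (j < n)%N by rewrite ltn_neqAle j_n.
  rewrite kE (bigD1 (Ordinal jn))//= gx// eqxx mulr1 big1 ?addr0 ?subrr//.
  move=> l /eqP lj; rewrite gx//; case: eqP => [e|_]; last by rewrite mulr0.
  by exfalso; apply: lj; apply: val_inj.
- by rewrite gz' ?(negbTE i_n)// ltn_neqAle i_n.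
- by apply: gx; rewrite ltn_neqAle ?i_n ?j_n.
Qed.

Definition backward_bounded S : set (dual X) :=
  [set f | exists (h : nat -> dual X) (C : R),
     [/\ h 0%N = f, forall k, h k = adjoint (S k) (h k.+1) & forall k, `|h k| <= C]].

Lemma backward_bounded_subspace S : linear_subspace (backward_bounded S).
Proof.
split=> [|a _ _ [h [C [<- hS hC]]] [k [D [<- kS kD]]]].
  exists (fun=> 0), 0; split=> // k; last by rewrite normr0.
  by rewrite linear0.
exists (fun n => a *: h n + k n), (`|a| * C + D); split=> // n.
  by rewrite hS kS linearP.
apply: le_trans (ler_normD _ _) _; apply: lerD; last exact: kD.
by rewrite normrZ ler_wpM2l.
Qed.

Lemma backward_bounded_commute S T f :
  (forall k, bop_comp (S k) T = bop_comp T (S k)) ->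
  backward_bounded S f -> backward_bounded S (adjoint T f).
Proof.
move=> ST [h [C [<- hS hC]]].
exists (fun n => adjoint T (h n)), (`|T| * C); split=> // n.
  by rewrite {1}hS -!adjoint_comp ST.
by apply: le_trans (adjoint_norm _ _) _; rewrite ler_wpM2l.
Qed.

(* The bounded backward orbits of an n-dimensional space of functionals yield, by integer
   combinations, [N ^ n] well separated points; pulled back [k] steps they lie in a ball that
   only [#|Q| ^ k] colours are needed to shrink, so [n] is bounded in terms of [#|Q|]. *)
Lemma backward_bounded_not_dense S (Q : finType) (col : dual X -> Q) :
  infinite_dimensional X ->
  (forall g h, `|g| <= 1 -> `|h| <= 1 -> col g = col h ->
     forall k, `|adjoint (S k) (g - h)| <= 2^-1) ->
  closure (backward_bounded S) <> setT.
Proof.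
move=> infX colP clT.
(* Since p < 2^p, p^(2a) <= 2^(2pa) < 2^(a(2p+1)) for a > 0: the 2^(an) coefficient vectors
   outnumber the colour words of length 2a. *)
pose p := #|Q|; pose n := (2 * p).+1.
have [x [g gx]] := biorthogonal_system n infX.
pose B : R := 1 + \sum_(j < n) `|x j|.
have B1 : 1 <= B by rewrite lerDl sumr_ge0.
have xB (j : 'I_n) : `|x j| <= B.
  by rewrite /B (bigD1 j)//= addrCA lerDl addr_ge0// sumr_ge0.
have nB0 : 0 < 2 * n%:R * B by rewrite !mulr_gt0// (lt_le_trans _ B1).
(* The precision 1/(2nB) leaves an error of at most 1/(2n) on evaluation at [x j], as |x j| <= B. *)
have /choice[orb orbP] : forall i : 'I_n, exists orb : (nat -> dual X) * R,
    [/\ `|orb.1 0%N - g i| <= (2 * n%:R * B)^-1,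
        forall k, orb.1 k = adjoint (S k) (orb.1 k.+1) & forall k, `|orb.1 k| <= orb.2].
  move=> i; have /closure_normP/(_ (2 * n%:R * B)^-1)[|f [h [C [<- hS hC]]] hg] :
      closure (backward_bounded S) (g i).
  - by rewrite clT.
  - by rewrite invr_gt0.
  by exists (h, C); split=> //; exact: ltW.
pose C : R := 1 + \sum_(i < n) (orb i).2.
have o20 i : 0 <= (orb i).2 by have [_ _ /(_ 0%N)] := orbP i; exact: le_trans.
have C0 : 0 < C by rewrite ltr_pwDl// sumr_ge0.
(* After 2a pullbacks the diameter bound 2^a C becomes C / 2^a, which is less than 1/(2B) by this
   choice. *)
have [a a0] : exists a : nat, 2 * C * B < 2 ^+ a.
  have /archi_boundP := mulr_ge0 (mulr_ge0 (ler0n R 2) (ltW C0)) (le_trans ler01 B1).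
  set a := Num.bound _ => ha; exists a; apply: (lt_trans ha).
  by rewrite -natrX ltr_nat ltn_expl.
pose I := {ffun 'I_n -> 'I_(2 ^ a)}.
pose h (s : I) k : dual X := \sum_(i < n) (s i)%:R *: (orb i).1 k.
have hB (s t : I) k : h s k - h t k = \sum_(i < n) ((s i)%:R - (t i)%:R) *: (orb i).1 k.
  by rewrite -sumrB; apply: eq_bigr => i _; rewrite scalerBl.
have hS s k : h s k = adjoint (S k) (h s k.+1).
  rewrite /h linear_sum; apply: eq_bigr => i _; rewrite linearZ.
  by congr (_ *: _); have [_ + _] := orbP i; exact.
have st_le (s t : I) i : `|(s i)%:R - (t i)%:R : R| <= 2 ^+ a.
  have lt2 (u : I) : ((u i)%:R : R) <= 2 ^+ a by rewrite -natrX ler_nat ltnW.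
  rewrite ler_norml; have := lt2 s; have := lt2 t.
  have := ler0n R (s i); have := ler0n R (t i); lra.
have hd (s t : I) k : s \in [set: I]%SET -> t \in [set: I]%SET ->
    `|h s k - h t k| <= 2 ^+ a * C.
  move=> _ _; rewrite hB (le_trans (ler_norm_sum _ _ _))// mulrDr mulr1.
  apply: le_trans (_ : 2 ^+ a * (\sum_(i < n) (orb i).2) <= _); last first.
    by rewrite lerDr exprn_ge0.
  rewrite mulr_sumr; apply: ler_sum => i _; rewrite normrZ ler_pM//.
  by have [_ _] := orbP i; exact.
have card : (#|Q| ^ (2 * a) < #|[set: I]%SET|)%N.
  rewrite cardsT card_ffun !card_ord -expnM.
  have a_gt0 : (0 < a)%N.
    rewrite lt0n; apply/eqP => a00; move: a0; rewrite a00 expr0.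
    have : 1 <= C by rewrite lerDl sumr_ge0.
    by move=> C1; apply/negP; rewrite -leNgt; nra.
  apply: leq_ltn_trans (_ : 2 ^ (p * (2 * a)) < _)%N.
    by rewrite (expnM 2) leq_exp2r ?muln_gt0// ltnW// ltn_expl.
  by rewrite ltn_exp2l// mulnC -mulnA [(a * p)%N]mulnC mulnA [ltnRHS]mulnC ltn_pmul2r.
have [s [t [st hst]]] := orbit_collision colP hS (mulr_gt0 (exprn_gt0 a (ltr0n R 2)) C0) card
  (fun s t => @hd s t (2 * a)%N).
pose m (i : 'I_n) : R := `|(s i)%:R - (t i)%:R|.
(* In the coordinate [j] where the coefficients differ most, evaluation at [x j] has absolute value
   at least m_j - n m_j / (2n) >= 1/2, against the upper bound [up]. *)
have [j _ mj] := @arg_maxP _ _ _ (ord0 : 'I_n) xpredT m isT.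
have mj1 : 1 <= m j.
  have [i sti] : exists i, s i != t i.
    apply: contrapT => /forallNP hn; move/eqP: st; apply; apply/ffunP => i.
    by apply/eqP; move: (hn i) => /negP; rewrite negbK.
  apply: le_trans (mj i isT).
  rewrite /m; have := sti; rewrite -(inj_eq val_inj)/= neq_ltn => /orP[] lt.
    rewrite distrC ger0_norm; first by rewrite -natrB ?(ltnW lt)// ler1n subn_gt0.
    by rewrite subr_ge0 ler_nat ltnW.
  rewrite ger0_norm; first by rewrite -natrB ?(ltnW lt)// ler1n subn_gt0.
  by rewrite subr_ge0 ler_nat ltnW.
have up : `|(h s 0%N - h t 0%N) (x j) : R| < 2^-1.
  apply: le_lt_trans (op_normP _ _) _.
  apply: le_lt_trans (_ : 2 ^+ a * C / 2 ^+ (2 * a) * B < _).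
    by apply: ler_pM; rewrite ?op_norm_ge0.
  have a2 : (0 : R) < 2 ^+ a by rewrite exprn_gt0.
  have -> : 2 ^+ a * C / 2 ^+ (2 * a) * B = C * B / 2 ^+ a.
    by rewrite mulnC exprM expr2; field; rewrite gt_eqF.
  by rewrite ltr_pdivrMr// ltr_pdivlMl// mulrA.
suff : 2^-1 <= `|(h s 0%N - h t 0%N) (x j) : R| by rewrite leNgt up.
have sumE (c : 'I_n -> R) (f : 'I_n -> dual X) w :
    ((\sum_(i < n) c i *: f i : dual X) w : R) = \sum_(i < n) c i * (f i w : R).
  by elim/big_ind2: _ => // [u b v d <- <-]; rewrite bopD.
rewrite hB sumE.
pose D i : R := ((orb i).1 0%N - g i) (x j).
have Dle i : `|D i| <= (2 * n%:R)^-1.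
  apply: le_trans (op_normP _ _) _; have [h1 _ _] := orbP i.
  apply: le_trans (ler_pM (op_norm_ge0 _) (normr_ge0 _) h1 (xB j)) _.
  by rewrite invfM -mulrA mulVf ?mulr1// gt_eqF// (lt_le_trans _ B1).
have -> : \sum_(i < n) ((s i)%:R - (t i)%:R) * ((orb i).1 0%N (x j) : R) =
    ((s j)%:R - (t j)%:R) + \sum_(i < n) ((s i)%:R - (t i)%:R) * D i.
  have E i : ((orb i).1 0%N (x j) : R) = (i == j)%:R + D i.
    by rewrite /D bopD bopN gx// addrC subrK.
  under eq_bigr do rewrite E mulrDr.
  rewrite big_split /= (bigD1 j)//= eqxx mulr1 big1 ?addr0//.
  by move=> i /negbTE ->; rewrite mulr0.
set w := \sum_(i < n) _.
have := ler_normB ((s j)%:R - (t j)%:R + w) w; rewrite addrK -/(m j).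
suff : `|w| <= m j / 2 by lra.
apply: le_trans (ler_norm_sum _ _ _) _.
apply: le_trans (_ : \sum_(i < n) m j * (2 * n%:R)^-1 <= _).
  by apply: ler_sum => i _; rewrite normrM ler_pM//; exact: mj.
have n0 : n%:R != 0 :> R by rewrite pnatr_eq0.
by rewrite sumr_const card_ord -mulr_natr le_eqVlt; apply/orP; left; apply/eqP; field.
Qed.

End BackwardOrbits.

(** * Weak* compactness and construction of a backward orbit *)

Section WeakStarCompactness.
Context {R : realType} {X : completeNormedModType R}.
Implicit Types (f g : dual X) (S T K : bounded_op X X).

Lemma ultra_finite_choice (I : Type) (J : choiceType) (F : set_system I)
    {FF : UltraFilter F} (t : I -> J) (s : seq J) :
  (\forall i \near F, t i \in s) -> exists2 j, j \in s & \forall i \near F, t i = j.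
Proof.
elim: s => [|j s IH] ts.
  by exfalso; apply: (@filter_not_empty _ F _); apply: filterS ts.
have [Fj|Fnj] := in_ultra_setVsetC [set i | t i = j] FF.
  by exists j => //; rewrite inE eqxx.
have [|k ks Fk] := IH.
  by apply: filterS2 ts Fnj => i; rewrite inE => /orP[/eqP|].
by exists k => //; rewrite inE ks orbT.
Qed.

(** Up to an error 1/2, an adjoint of small essential norm turns bounded weak* convergence into norm
    convergence: only the finitely many points of [adjoint_net] matter. *)
Lemma ultra_adjoint (I : Type) (F : set_system I) {FF : ProperFilter F} (u : I -> dual X) g T :
  essential_norm T < 8^-1 -> (forall x, u i x @[i --> F] --> g x) ->
  (\forall i \near F, `|u i - g| <= 2) ->
  \forall i \near F, `|adjoint T (u i) - adjoint T g| <= 2^-1.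
Proof.
move=> T8 ug u2; have [ys ysP] := adjoint_net T8.
have near_ys : \forall i \near F, forall y, y \in ys -> `|(u i - g) y : R| <= 12^-1.
  elim: (ys) => [|y s IH]; first by apply: filterE.
  have /cvgrPdist_le/(_ 12^-1) := ug y.
  rewrite invr_gt0 => /(_ (ltr0n _ _)) uy.
  apply: filterS2 IH uy => i IHi uy z; rewrite inE => /orP[/eqP->|/IHi//].
  by rewrite bopD bopN distrC.
apply: filterS2 u2 near_ys => i ui2 uiys.
by rewrite -linearB; exact: ysP.
Qed.

(** If no finite list works, the sets [Z Ts] generate a proper filter. Along a finer ultrafilter f
    tends weak* to some g in the ball; the operator T given for g has |T^* g - f0| < 1/2 and
    eventually |T^* f - T^* g| <= 1/2, contradicting f in [Z [:: T]]. *)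
Lemma finite_subcover (A : set (bounded_op X X)) (f0 : dual X) :
  (forall f, `|f - f0| <= 1 -> exists T, [/\ A T, essential_norm T < 8^-1 &
     `|adjoint T f - f0| < 2^-1]) ->
  exists2 Ts : seq (bounded_op X X), forall T, T \in Ts -> A T /\ essential_norm T < 8^-1 &
    forall f, `|f - f0| <= 1 -> exists2 T, T \in Ts & `|adjoint T f - f0| <= 1.
Proof.
move=> cover; apply: contrapT => noTs.
pose D := [set Ts : seq (bounded_op X X) | forall T, T \in Ts -> A T /\ essential_norm T < 8^-1].
pose Z (Ts : seq (bounded_op X X)) :=
  [set f : dual X | `|f - f0| <= 1 /\ forall T, T \in Ts -> 1 < `|adjoint T f - f0|].
have PF : ProperFilter (filter_from D Z).
  apply: filter_from_proper; last first.
    move=> Ts DTs; apply: contrapT => Z0; apply: noTs; exists Ts => // f f1.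
    apply: contrapT => nT; apply: Z0; exists f; split=> // T TTs.
    by rewrite ltNge; apply/negP => Tf; apply: nT; exists T.
  apply: filter_from_filter; first by exists [::].
  move=> Ts Us DTs DUs; exists (Ts ++ Us).
    by move=> T; rewrite mem_cat => /orP[/DTs|/DUs].
  move=> f [f1 fTU]; split; split=> // T TTs; apply: fTU; by rewrite mem_cat TTs ?orbT.
have [U [UU ZU]] := ultraFilterLemma PF.
have UZ T : A T -> essential_norm T < 8^-1 -> U (Z [:: T]).
  move=> AT T8; apply: ZU; exists [:: T]; last exact: subset_refl.
  by move=> S; rewrite inE => /eqP->.
have U1 : \forall f \near U, `|f - f0| <= 1.
  by apply: ZU; exists [::]; [move=> T|move=> f []].
have [|g gU] := @ultra_pointwise_limit _ _ _ U _ id (`|f0| + 1).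
  apply: filterS U1 => f f1; rewrite -[X in `|X|](subrK f0) addrC.
  by apply: le_trans (ler_normD _ _) _; rewrite lerD2l.
have g1 : `|g - f0| <= 1 by apply: (@pointwise_limit_ball _ _ _ U _ id).
have [T [AT T8 Tg]] := cover g g1.
have U2 : \forall f \near U, `|f - g| <= 2.
  apply: filterS U1 => f f1; apply: le_trans (ler_distD f0 f g) _.
  have g1' : `|f0 - g| <= 1 by rewrite distrC; exact: g1.
  exact: le_trans (lerD f1 g1') _.
have Tlim : \forall f \near U, `|adjoint T f - adjoint T g| <= 2^-1.
  exact: (ultra_adjoint T8 gU U2).
have /filter_ex[f [[_ /(_ T (mem_head _ _)) h1] h2]] :
    U (Z [:: T] `&` [set f | `|adjoint T f - adjoint T g| <= 2^-1]).
  by apply: filterI; [exact: UZ|exact: Tlim].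
have h3 := le_trans (ler_distD (adjoint T g) (adjoint T f) f0) (lerD h2 (ltW Tg)).
by have := lt_le_trans h1 h3; rewrite -div1r -splitr ltxx.
Qed.

(** A forward orbit [f] inside the ball is read backwards from n, and n tends to infinity along an
    ultrafilter: [g k] is the weak* limit of [f (n - k)]. As [Ts] is finite, the operator applied to
    [f (n - k.+1)] is constant along the ultrafilter; it is [S k]. *)
Lemma backward_orbit (Ts : seq (bounded_op X X)) (f0 : dual X) :
  (forall f, `|f - f0| <= 1 -> exists2 T, T \in Ts & `|adjoint T f - f0| <= 1) ->
  exists (S : nat -> bounded_op X X) (g : nat -> dual X),
    [/\ forall k, S k \in Ts, forall k, `|g k - f0| <= 1 &
        forall k, g k = adjoint (S k) (g k.+1)].
Proof.
move=> TsP.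
have stepP f : exists T, `|f - f0| <= 1 -> T \in Ts /\ `|adjoint T f - f0| <= 1.
  have [/TsP[T TTs Tf]|nf] := pselect (`|f - f0| <= 1); first by exists T.
  by exists 0.
have [step {}stepP] := choice stepP.
pose f := fix f n := if n is m.+1 then adjoint (step (f m)) (f m) else f0.
have f1 n : `|f n - f0| <= 1.
  by elim: n => [|n IH] /=; [rewrite subrr normr0|have [] := stepP _ IH].
have fC n : `|f n| <= `|f0| + 1.
  rewrite -[X in `|X|](subrK f0) addrC.
  by apply: le_trans (ler_normD _ _) _; rewrite lerD2l.
have [U [UU ooU]] := ultraFilterLemma (eventually_filter).
have limg k : exists g, forall x, f (n - k)%N x @[n --> U] --> g x.
  by apply: (@ultra_pointwise_limit _ _ _ U _ _ (`|f0| + 1)); apply: filterE => n.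
have [g gP] := choice limg.
have limS k : exists T, T \in Ts /\ \forall n \near U, step (f (n - k.+1)%N) = T.
  have [|T TTs UT] := @ultra_finite_choice _ _ U _ (fun n => step (f (n - k.+1)%N)) Ts.
    by apply: filterE => n; have [] := stepP _ (f1 (n - k.+1)%N).
  by exists T.
have [S SP] := choice limS.
exists S, g; split=> k; first exact: (SP k).1.
  by apply: (pointwise_limit_ball (gP k)); apply: filterE => n; exact: f1.
apply: bop_ext => x; rewrite adjointE.
apply: (cvg_unique _ (gP k x)); first exact: norm_hausdorff.
apply: cvg_trans (gP k.+1 (S k x)); apply: near_eq_cvg.
(* For n > k, [n - k] is the successor of [n - k.+1], so the recursion of [f] unfolds. *)
have Uk : \forall n \near U, (k < n)%N by apply: ooU; exists k.+1.
apply: filterS2 (SP k).2 Uk => n <- kn.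
by rewrite -(subnSK kn) /=.
Qed.

(** All [S k] come from one finite list, so one colouring serves every step. The subspace is nonzero
    since [g 0] lies in the unit ball around [f0], which misses 0. *)
Lemma compact_case (A : set (bounded_op X X)) (f0 : dual X) :
  infinite_dimensional X -> commuting A -> 1 < `|f0| ->
  (forall f, `|f - f0| <= 1 -> exists T, [/\ A T, essential_norm T < 8^-1 &
     `|adjoint T f - f0| < 2^-1]) ->
  exists L : set (dual X), [/\ closed L, linear_subspace L, L <> [set 0], L <> setT &
    forall T, A T -> forall f, L f -> L (adjoint T f)].
Proof.
move=> infX commA f01 /finite_subcover[Ts TsA TsB].
have [S [g [STs g1 gS]]] := backward_orbit TsB.
have [Q [col colP]] := adjoint_coloring (fun T TTs => (TsA T TTs).2).
exists (closure (backward_bounded S)); split.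
- exact: closed_closure.
- exact/closure_linear_subspace/backward_bounded_subspace.
- have Bg : backward_bounded S (g 0%N).
    exists g, (1 + `|f0|); split=> // k; rewrite -[X in `|X|](subrK f0).
    by apply: le_trans (ler_normD _ _) _; rewrite lerD2r.
  move=> L0; have : closure (backward_bounded S) (g 0%N) by exact: subset_closure.
  rewrite L0 => /= g00; have := g1 0%N; rewrite g00 sub0r normrN leNgt.
  by rewrite f01.
- apply: (@backward_bounded_not_dense _ _ S Q col infX) => f h f1' h1 fh k.
  exact: (colP f h f1' h1 fh).
- move=> T AT f Lf; apply: (@closure_map _ _ _ _ _ _ `|T|) Lf.
    by move=> u v; exact: adjoint_lip.
  move=> h Bh; apply: subset_closure; apply: backward_bounded_commute => // k.
  by apply: commA => //; exact: (TsA _ (STs k)).1.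
Qed.

End WeakStarCompactness.

(** * Essential norm and positivity *)

Section EssentialNorm.
Context {R : realType} {X : completeNormedModType R}.
Implicit Types (S T K L V W : bounded_op X X).

Lemma compact_op_sub K (C : set X) : compact C ->
  (forall x, `|x| <= 1 -> C (K x)) -> compact_op K.
Proof.
move=> cC KC; apply: (@precompact_subset _ _ C); first by move=> _ [x /KC Cx <-].
by apply: compact_precompact => //; exact: norm_hausdorff.
Qed.

Lemma compact_op_closure K : compact_op K ->
  compact (closure [set K x | x in [set x : X | `|x| <= 1]]).
Proof. by rewrite /compact_op precompactE. Qed.

Lemma compact_op_closureP K x : `|x| <= 1 ->
  closure [set K x | x in [set x : X | `|x| <= 1]] (K x).
Proof. by move=> x1; apply: subset_closure; exists x. Qed.

Lemma compact_opD K L : compact_op K -> compact_op L -> compact_op (K + L).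
Proof.
move=> /compact_op_closure cK /compact_op_closure cL.
have c := @continuous_compact _ _ (fun p : X * X => p.1 + p.2) _ _ (compact_setX cK cL).
apply: (compact_op_sub (c _)).
  by apply: continuous_subspaceT => p; exact: add_continuous.
by move=> x x1; exists (K x, L x) => //; split; exact: compact_op_closureP.
Qed.

Lemma compact_op_compl T K : compact_op K -> compact_op (bop_comp T K).
Proof.
move=> /compact_op_closure cK.
have c := @continuous_compact _ _ T _ _ cK.
apply: (compact_op_sub (c _)).
  by apply: continuous_subspaceT; exact: bop_continuous.
by move=> x x1; exists (K x) => //; exact: compact_op_closureP.
Qed.

Lemma compact_opZ (a : R) K : compact_op K -> compact_op (a *: K).
Proof.
move=> cK; suff -> : a *: K = bop_comp (a *: bop_id X) K by exact: compact_op_compl.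
by apply: bop_ext.
Qed.

Lemma compact_op_compr K T : compact_op K -> compact_op (bop_comp K T).
Proof.
move=> cK; have m0 : 0 < `|T| + 1 by rewrite ltr_pwDr.
have /compact_op_closure c := compact_opZ (`|T| + 1) cK.
apply: (compact_op_sub c) => x x1.
have -> : bop_comp K T x = ((`|T| + 1) *: K) ((`|T| + 1)^-1 *: T x).
  by rewrite bopZ linearZ /= scalerA divff ?gt_eqF// scale1r.
apply: compact_op_closureP; rewrite normrZ gtr0_norm ?invr_gt0// ler_pdivrMl// mulr1.
by apply: le_trans (op_norm_le1 T x1) _; rewrite lerDl.
Qed.

Lemma essential_normZ_lt (c a : R) T : 0 < c -> essential_norm T < a ->
  essential_norm (c *: T) < c * a.
Proof.
move=> c0 /essential_norm_lt[K cK TK].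
apply: le_lt_trans (essential_norm_le _ (compact_opZ c cK)) _.
by rewrite -scalerDr normrZ gtr0_norm// ltr_pM2l.
Qed.

Lemma essential_normD_le S T : essential_norm (S + T) <= essential_norm S + essential_norm T.
Proof.
apply/ler_addgt0Pr => e e0; have e20 : 0 < e / 2 by rewrite divr_gt0.
have [|K cK SK] := @essential_norm_lt _ _ S (essential_norm S + e / 2); first by rewrite ltrDl.
have [|L cL TL] := @essential_norm_lt _ _ T (essential_norm T + e / 2); first by rewrite ltrDl.
apply: le_trans (essential_norm_le _ (compact_opD cK cL)) _.
rewrite addrACA; apply: le_trans (ler_normD _ _) _; apply: le_trans (lerD (ltW SK) (ltW TL)) _.
by rewrite addrACA -splitr.
Qed.

(** (S + K)(V + L) differs from SV by a compact operator. The number [s], strictly between |S + K|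
    and [a], is positive even if S + K = 0, so it can be divided by. *)
Lemma essential_norm_comp_lt S V (a r : R) : 0 < r -> essential_norm S < a ->
  essential_norm V <= r -> essential_norm (bop_comp S V) < a * r.
Proof.
move=> r0 /essential_norm_lt[K cK SK] Vr.
pose s := (`|S + K| + a) / 2.
have n0 := normr_ge0 (S + K).
have sS : `|S + K| < s by rewrite /s; move: SK n0; move: `|_| => z; lra.
have sa : s < a by rewrite /s; move: SK n0; move: `|_| => z; lra.
have s0 : 0 < s by exact: le_lt_trans n0 sS.
have [|L cL VL] := @essential_norm_lt _ _ V (a * r / s).
  by apply: le_lt_trans Vr _; rewrite ltr_pdivlMr// mulrC ltr_pM2r.
have c : compact_op (bop_comp S L + bop_comp K (V + L)).
  by apply: compact_opD; [exact: compact_op_compl|exact: compact_op_compr].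
apply: le_lt_trans (essential_norm_le _ c) _.
have -> : bop_comp S V + (bop_comp S L + bop_comp K (V + L)) = bop_comp (S + K) (V + L).
  by rewrite bop_compDl addrA -bop_compDr.
apply: le_lt_trans (bop_comp_norm _ _) _.
apply: le_lt_trans (_ : s * `|V + L| < _); first by rewrite ler_wpM2r// ltW.
by rewrite mulrC -ltr_pdivlMr.
Qed.

Lemma essential_norm_lt_norm T (a : R) : `|T| < a -> essential_norm T < a.
Proof.
move=> Ta; apply: le_lt_trans Ta; rewrite -[X in _ <= `|X|]addr0.
exact: essential_norm_le compact_op0.
Qed.

Definition ess_pos W := forall eta : R, 0 < eta -> exists2 d : R, 0 < d &
  forall e, 0 < e -> e < d -> essential_norm (bop_id X - e *: W) <= 1 + eta * e.

Lemma essentially_positive_ess_pos W : essentially_positive W -> ess_pos W.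
Proof.
move=> [h /eqoP ho hW] eta eta0; have [d /= d0 dP] := filterI hW (ho _ eta0).
exists d => // e e0 ed; have [] := dP e.
- by rewrite /= sub0r normrN gtr0_norm.
- by [].
move=> h1 h2; apply: le_trans h1 _; rewrite lerD2l.
apply: le_trans (ler_norm _) _; move: h2; rewrite (gtr0_norm e0); exact.
Qed.

(** 1 - e(V + W) is the average of 1 - 2eV and 1 - 2eW. *)
Lemma ess_posD V W : ess_pos V -> ess_pos W -> ess_pos (V + W).
Proof.
move=> pV pW eta eta0; have eta20 : 0 < eta / 2 by rewrite divr_gt0.
have [d1 d10 h1] := pV _ eta20; have [d2 d20 h2] := pW _ eta20.
exists (Num.min d1 d2 / 2); first by rewrite divr_gt0// lt_min d10.
move=> e e0; rewrite ltr_pdivlMr// lt_min => /andP[ed1 ed2].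
have e20 : 0 < e * 2 by rewrite mulr_gt0.
have half (U : bounded_op X X) : essential_norm (bop_id X - (e * 2) *: U) <= 1 + eta / 2 * (e * 2) ->
    essential_norm (2^-1 *: (bop_id X - (e * 2) *: U)) <= 2^-1 * (1 + eta * e).
  move=> hU; apply/ler_addgt0Pr => r r0; apply: ltW.
  have -> : 2^-1 * (1 + eta * e) + r = 2^-1 * (1 + eta * e + 2 * r) by field.
  apply: essential_normZ_lt; first by rewrite invr_gt0.
  apply: le_lt_trans hU _.
  by rewrite (_ : eta / 2 * (e * 2) = eta * e) ?ltrDl ?mulr_gt0//; field.
have -> : bop_id X - e *: (V + W) =
    2^-1 *: (bop_id X - (e * 2) *: V) + 2^-1 *: (bop_id X - (e * 2) *: W).
  rewrite -scalerDr addrACA -opprD -scalerDr scalerBr scalerA mulrCA mulVf// mulr1.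
  by rewrite -mulr2n -(scaler_nat 2 (bop_id X)) scalerA mulVf// scale1r.
apply: le_trans (essential_normD_le _ _) _.
apply: le_trans (lerD (half _ (h1 _ e20 ed1)) (half _ (h2 _ e20 ed2))) _.
by rewrite -mulrDl -div1r -splitr mul1r.
Qed.

End EssentialNorm.

(** * Cones, square roots and sums of squares *)

Section DualGeometry.
Context {R : realType} {X : completeNormedModType R}.
Hypothesis infX : infinite_dimensional X.
Implicit Types f g : dual X.

Lemma not_proportional f : exists (v : dual X) (x : X), (f x : R) = 0 /\ (v x : R) != 0.
Proof.
have [x [g gx]] := biorthogonal_system 2 infX.
have [f0|f0] := eqVneq (f (x 0%N) : R) 0.
  by exists (g 0%N), (x 0%N); rewrite gx// oner_eq0.
exists (g 1%N), (x 1%N - ((f (x 1%N) : R) / (f (x 0%N) : R)) *: x 0%N).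
rewrite !linearB !linearZ /= !gx//= /GRing.scale/=.
by rewrite oppr0 mulr0 addr0 oner_eq0 mulrN divfK ?subrr.
Qed.

Lemma dual_neq0 f : f != 0 -> exists y, (f y : R) != 0.
Proof.
move=> /eqP f0; apply: contrapT => /forallNP hy; apply: f0; apply: bop_ext => y.
by apply/eqP; move: (hy y) => /negP; rewrite negbK.
Qed.

Lemma dual_norm_pairing f x : `|f x : R| <= `|f| * `|x|.
Proof. exact: op_normP. Qed.

Lemma annihilator_closed (A : set X) :
  closed [set g : dual X | forall w, A w -> (g w : R) = 0].
Proof.
move=> g gA w Aw; apply/eqP; rewrite -normr_le0; apply/ler_addgt0Pr => e e0; rewrite add0r.
have w0 : 0 < `|w| + 1 by rewrite ltr_pwDr.
have /closure_normP/(_ _ (divr_gt0 e0 w0))[s sA sg] := gA.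
have -> : (g w : R) = - (s - g) w by rewrite bopD bopN (sA w Aw) add0r opprK.
rewrite normrN; apply: le_trans (dual_norm_pairing _ _) _.
apply: le_trans (_ : `|s - g| * (`|w| + 1) <= _); first by rewrite ler_wpM2l// lerDl.
by rewrite -ler_pdivlMr// ltW.
Qed.

Variable C : set (dual X).
Hypotheses (clC : closed C) (CZ : forall (a : R) f, 0 <= a -> C f -> C (a *: f)).

(* Otherwise [C] would be relatively open away from the origin, which is
   impossible for a proper cone in dimension at least 2. *)
Lemma cone_exit (c w : dual X) : C c -> c != 0 -> ~ C w ->
  exists u c', [/\ ~ C u, C c' & `|c' - u| < `|u|].
Proof.
move=> Cc c0 nCw; apply: contrapT => H.
have far (u c' : dual X) : ~ C u -> C c' -> `|u| <= `|c' - u|.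
  move=> nCu Cc'; rewrite leNgt; apply/negP => lt; apply: H.
  by exists u, c'.
(* By [far], a step from [C] to u of length less than |u| cannot leave [C]. On the line k + s v the
   norm is at least |k x| / |x|, so short steps of length |v| / n lead from k to k + v. *)
have translate (k v : dual X) x : C k -> (k x : R) != 0 -> (v x : R) = 0 -> C (k + v).
  move=> Ck kx vx.
  have x0 : 0 < `|x|.
    by rewrite normr_gt0; apply/eqP => x0; move/eqP: kx; rewrite x0 linear0.
  have m0 : 0 < `|k x : R| / `|x| by rewrite divr_gt0// normr_gt0.
  have big (t : R) : `|k x : R| / `|x| <= `|k + t *: v|.
    rewrite ler_pdivrMr//; have -> : (k x : R) = (k + t *: v) x.
      by rewrite bopD bopZ vx /GRing.scale/= mulr0 addr0.
    exact: dual_norm_pairing.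
  pose n := (Num.truncn (`|v| / (`|k x : R| / `|x|))).+1.
  have nP : `|v| / n%:R < `|k x : R| / `|x|.
    by rewrite ltr_pdivrMr// mulrC -ltr_pdivrMr// truncnS_gt.
  have walk i : C (k + (i%:R / n%:R) *: v).
    elim: i => [|i IH]; first by rewrite mul0r scale0r addr0.
    apply: contrapT => nC; have := far _ _ nC IH.
    rewrite opprD addrACA subrr add0r -scalerBl -mulrBl -natr1 opprD addNKr.
    rewrite mulN1r scaleNr normrN normrZ ger0_norm ?invr_ge0//.
    by move=> /(le_trans (big _)); rewrite [_^-1 * _]mulrC leNgt nP.
  by have := walk n; rewrite divff ?scale1r// pnatr_eq0.
(* t k + v = t (k + v / t) lies in [C] and tends to v as t tends to 0. *)
have plane (k v : dual X) x : C k -> (k x : R) != 0 -> (v x : R) = 0 -> C v.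
  move=> Ck kx vx; apply: clC; apply/closure_normP => e e0.
  pose t : R := e / (2 * (`|k| + 1)).
  have k0 : 0 < `|k| + 1 by rewrite ltr_pwDr.
  have t0 : 0 < t by rewrite divr_gt0// mulr_gt0.
  exists (t *: (k + t^-1 *: v)).
    apply: CZ; first exact: ltW.
    by apply: (translate _ _ x) => //; rewrite bopZ vx /GRing.scale/= mulr0.
  rewrite scalerDr scalerA divff ?gt_eqF// scale1r addrK normrZ gtr0_norm//.
  rewrite /t mulrAC ltr_pdivrMr ?mulr_gt0// ltr_pM2l//.
  by have := normr_ge0 k; move: `|k| => z; lra.
(* If some x is killed by [w] but not by [c], then [plane] leads from [c] to [w]; otherwise it does
   so through some v not proportional to [w]. *)
apply: nCw.
have [[x [wx cx]]|nx] := pselect (exists x, (w x : R) = 0 /\ (c x : R) != 0).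
  exact: plane Cc cx wx.
have [v [x [wx vx]]] := not_proportional w.
have cx : (c x : R) = 0 by apply/eqP; apply: contrapT => /negP cx; apply: nx; exists x.
have [y cy] := dual_neq0 c0.
suff Cv : C v by exact: plane Cv vx wx.
apply: (plane c v (y - ((v y : R) / (v x : R)) *: x)) => //.
  by rewrite linearB linearZ /= cx /GRing.scale/= mulr0 subr0.
by rewrite linearB linearZ /= /GRing.scale/= divfK ?subrr.
Qed.

End DualGeometry.

Section SquareRoot.
Context {R : realType} {X : completeNormedModType R}.
Variables (A : set (bounded_op X X)).
Hypotheses (algA : subalgebra A) (commA : commuting A).
Implicit Types (S T V W : bounded_op X X).

Lemma algebraD S T : A S -> A T -> A (S + T).
Proof. by move=> AS AT; rewrite -(scale1r S); case: algA => _ + _; exact. Qed.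

Lemma algebraZ (a : R) S : A S -> A (a *: S).
Proof. by move=> AS; rewrite -(addr0 (a *: S)); case: algA => A0 + _; apply. Qed.

Lemma algebraB S T : A S -> A T -> A (S - T).
Proof. by move=> AS AT; rewrite -scaleN1r; apply: algebraD => //; exact: algebraZ. Qed.

Lemma algebraM S T : A S -> A T -> A (bop_comp S T).
Proof. by case: algA => _ _; exact. Qed.

(* [1 - sqrt_iter a n] converges to a square root of [1 - a]. *)
Fixpoint sqrt_iter (a : bounded_op X X) n : bounded_op X X :=
  if n is m.+1 then 2^-1 *: (a + bop_comp (sqrt_iter a m) (sqrt_iter a m)) else 0.

Lemma sqrt_iter_algebra a n : A a -> A (sqrt_iter a n).
Proof.
move=> Aa; elim: n => [|n IH] /=; first by case: algA.
by apply/algebraZ/algebraD => //; exact: algebraM.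
Qed.

Lemma sqrt_iter_norm a n : `|a| <= 2^-1 -> `|sqrt_iter a n| <= 2^-1.
Proof.
move=> a2; elim: n => [|n IH] /=; first by rewrite normr0.
rewrite normrZ ger0_norm ?invr_ge0//.
have h : `|bop_comp (sqrt_iter a n) (sqrt_iter a n)| <= 2^-1 * 2^-1.
  by apply: le_trans (bop_comp_norm _ _) _; apply: ler_pM.
have := le_trans (ler_normD _ _) (lerD a2 h).
by move: `|_| => z; lra.
Qed.

Lemma bop_sqrB S T : bop_comp T (T - S) + bop_comp (T - S) S = bop_comp T T - bop_comp S S.
Proof.
apply: bop_ext => x; rewrite !(bopD, bopN) /= ?(bopD, bopN) linearB /=.
by rewrite addrA subrK.
Qed.

Lemma bop_polarization S T : bop_comp S T = bop_comp T S ->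
  bop_comp S T = bop_comp (2^-1 *: (S + T)) (2^-1 *: (S + T))
               - bop_comp (2^-1 *: (S - T)) (2^-1 *: (S - T)).
Proof.
move=> ST; rewrite -bop_sqrB.
have half2 (U : bounded_op X X) : 2^-1 *: (U + U) = U.
  by rewrite -mulr2n -(scaler_nat 2 U) scalerA mulVf// scale1r.
have -> : 2^-1 *: (S + T) - 2^-1 *: (S - T) = T.
  by rewrite -scalerBr opprB [T - S]addrC addrACA subrr add0r half2.
rewrite bop_compZl bop_compZr -scalerDr bop_compDl bop_compDr -(scaleN1r T) bop_compZr.
by rewrite scaleN1r addrACA subrr addr0 -ST half2.
Qed.

(** By [bop_sqrB], the map r -> (a + r^2) / 2 is 1/2-Lipschitz on the ball of radius 1/2. *)
Lemma sqrt_iter_step a n : `|a| <= 2^-1 ->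
  `|sqrt_iter a n.+1 - sqrt_iter a n| <= 2^-1 ^+ n.
Proof.
move=> a2; elim: n => [|n IH].
  by rewrite subr0 expr0; apply: le_trans (sqrt_iter_norm 1 a2) _; lra.
have -> : sqrt_iter a n.+2 - sqrt_iter a n.+1 = 2^-1 *:
    (bop_comp (sqrt_iter a n.+1) (sqrt_iter a n.+1) - bop_comp (sqrt_iter a n) (sqrt_iter a n)).
  by rewrite [LHS]/= -scalerBr opprD addrACA subrr add0r.
rewrite -bop_sqrB.
have := lerD (sqrt_iter_norm n.+1 a2) (sqrt_iter_norm n a2).
move: IH; set r := sqrt_iter a n; set r' := sqrt_iter a n.+1 => IH rr.
rewrite normrZ ger0_norm ?invr_ge0// exprS ler_pM2l ?invr_gt0//.
apply: le_trans (ler_normD _ _) _.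
apply: le_trans (lerD (bop_comp_norm _ _) (bop_comp_norm _ _)) _.
rewrite mulrC -mulrDr; apply: le_trans IH; rewrite ler_piMr//.
by move: rr; rewrite -div1r -splitr.
Qed.

(** (1 - r)^2 = 1 - a + (a + r^2 - 2r); for an iterate r the bracket is twice the next increment. *)
Lemma sqr_sub_comp a r T : bop_comp T r = bop_comp r T ->
  bop_comp (T - bop_comp r T) (T - bop_comp r T) =
  bop_comp T T - bop_comp a (bop_comp T T)
  + bop_comp (2 *: (2^-1 *: (a + bop_comp r r) - r)) (bop_comp T T).
Proof.
move=> comm_Tr; have Tr x : T (r x) = r (T x).
  by have := congr1 (fun S : bounded_op X X => S x) comm_Tr.
have compE (U V : bounded_op X X) y : bop_comp U V y = U (V y) by [].
apply: bop_ext => x; rewrite !(bopD, bopN, bopZ, compE) !linearB /= !Tr.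
rewrite scalerA divff// scale1r scaler_nat mulr2n opprK -!addrA; congr (_ + _).
by rewrite addKr addrA [LHS]addrC opprD.
Qed.

Lemma sqrt_iter_square a n T : A a -> A T ->
  bop_comp (T - bop_comp (sqrt_iter a n) T) (T - bop_comp (sqrt_iter a n) T) =
  bop_comp T T - bop_comp a (bop_comp T T)
  + bop_comp (2 *: (sqrt_iter a n.+1 - sqrt_iter a n)) (bop_comp T T).
Proof.
by move=> Aa AT; apply: sqr_sub_comp; apply: commA => //; exact: sqrt_iter_algebra.
Qed.

End SquareRoot.

Section SumsOfSquares.
Context {R : realType} {X : completeNormedModType R}.
Variables (A : set (bounded_op X X)).
Hypotheses (algA : subalgebra A) (commA : commuting A).
Implicit Types (S T V W : bounded_op X X) (f g z : dual X).

Inductive sum_squares : bounded_op X X -> Prop :=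
| sum_squares1 T : A T -> sum_squares (bop_comp T T)
| sum_squaresD V W : sum_squares V -> sum_squares W -> sum_squares (V + W).

Lemma sum_squares_algebra W : sum_squares W -> A W.
Proof.
by elim=> [T AT|V U _ AV _ AU]; [exact: algebraM|exact: algebraD].
Qed.

Lemma sum_squares_ess_pos W : (forall T, A T -> essentially_real T) ->
  sum_squares W -> ess_pos W.
Proof.
move=> realA; elim=> [T AT|V U _ pV _ pU]; last exact: ess_posD.
exact/essentially_positive_ess_pos/realA.
Qed.

Lemma sum_squaresZ (a : R) W : 0 <= a -> sum_squares W -> sum_squares (a *: W).
Proof.
move=> a0; elim=> [T AT|V U _ pV _ pU]; last by rewrite scalerDr; exact: sum_squaresD.
have -> : a *: bop_comp T T = bop_comp (Num.sqrt a *: T) (Num.sqrt a *: T).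
  by rewrite bop_compZl bop_compZr scalerA -expr2 sqr_sqrtr.
by apply: sum_squares1; exact: algebraZ.
Qed.

Lemma sum_squares_mul T W : A T -> sum_squares W -> sum_squares (bop_comp W (bop_comp T T)).
Proof.
move=> AT; elim=> [S AS|V U _ pV _ pU]; last by rewrite bop_compDl; exact: sum_squaresD.
have -> : bop_comp (bop_comp S S) (bop_comp T T) = bop_comp (bop_comp S T) (bop_comp S T).
  by rewrite -!bop_compA; congr bop_comp; rewrite !bop_compA (commA AS AT).
by apply: sum_squares1; exact: algebraM.
Qed.

(** The closed convex cone generated by all (T^2)^* y; [sum_squaresZ] absorbs nonnegative scalars
    into T. *)
Definition square_cone (y : dual X) := closure [set adjoint W y | W in sum_squares].

Lemma square_cone1 y T : A T -> square_cone y (adjoint (bop_comp T T) y).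
Proof. by move=> AT; apply: subset_closure; exists (bop_comp T T) => //; exact: sum_squares1. Qed.

Lemma square_coneZ y (a : R) f : 0 <= a -> square_cone y f -> square_cone y (a *: f).
Proof.
move=> a0; apply: (@closure_map _ _ _ _ _ (fun f => a *: f) `|a|).
  by move=> u v; rewrite -scalerBr normrZ.
move=> _ [W sW <-]; rewrite -adjoint_scalel; apply: subset_closure; exists (a *: W) => //.
exact: sum_squaresZ.
Qed.

Lemma square_coneD y f g : square_cone y f -> square_cone y g -> square_cone y (f + g).
Proof.
move=> /closure_normP Cf /closure_normP Cg; apply/closure_normP => e e0.
have e20 : 0 < e / 2 by rewrite divr_gt0.
have [_ [V sV <-] Vf] := Cf _ e20; have [_ [W sW <-] Wg] := Cg _ e20.
exists (adjoint (V + W) y); first by exists (V + W) => //; exact: sum_squaresD.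
rewrite adjoint_addl opprD addrACA; apply: le_lt_trans (ler_normD _ _) _.
by rewrite (splitr e); exact: ltrD.
Qed.

Lemma square_cone_square y T f : A T -> square_cone y f ->
  square_cone y (adjoint (bop_comp T T) f).
Proof.
move=> AT; apply: (@closure_map _ _ _ _ _ _ `|bop_comp T T|).
  by move=> u v; exact: adjoint_lip.
move=> _ [W sW <-]; rewrite -adjoint_comp; apply: subset_closure.
exists (bop_comp W (bop_comp T T)) => //.
exact: sum_squares_mul.
Qed.

(** For a = e V^2 with iterates r_n, the operator (1 - a) T^2 is the limit of the squares of T - r_n
    T, which lies in [A] even if 1 - r_n does not. The bound 1/2 makes the iteration converge. *)
Lemma square_cone_sub_square y V f (e : R) : A V -> 0 <= e ->
  e * `|bop_comp V V| <= 2^-1 -> square_cone y f ->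
  square_cone y (f - e *: adjoint (bop_comp V V) f).
Proof.
move=> AV e0 eV; pose a := e *: bop_comp V V.
have Aa : A a by apply: algebraZ => //; exact: algebraM.
have a2 : `|a| <= 2^-1 by rewrite normrZ ger0_norm.
have aE h : e *: adjoint (bop_comp V V) h = adjoint a h by rewrite adjoint_scalel.
rewrite aE; apply: (@closure_map _ _ _ _ _ (fun f => f - adjoint a f) (1 + `|a|)).
  move=> u v; have -> : u - adjoint a u - (v - adjoint a v) = (u - v) - adjoint a (u - v).
    by rewrite [adjoint a (u - v)]linearB /= !opprB addrACA [RHS]addrACA; congr (_ + _); rewrite addrC.
  apply: le_trans (ler_normB _ _) _; rewrite mulrDl mul1r lerD2l.
  exact: adjoint_norm.
move=> _ [W sW <-]; elim: sW => [T AT|U W' _ CU _ CW]; last first.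
  have -> : adjoint (U + W') y - adjoint a (adjoint (U + W') y) =
      (adjoint U y - adjoint a (adjoint U y)) + (adjoint W' y - adjoint a (adjoint W' y)).
    by rewrite adjoint_addl linearD /= opprD addrACA.
  exact: square_coneD.
set r := sqrt_iter a.
have Tr : bop_comp (bop_comp T T) a = bop_comp a (bop_comp T T).
  by apply: commA => //; exact: algebraM.
apply/closure_normP => e1 e10.
pose M := 2 * `|bop_comp T T| * `|y| + 1.
have M0 : 0 < M by rewrite ltr_pwDr// !mulr_ge0.
have h1 : `|2^-1 : R| < 1 by rewrite ger0_norm ?invr_ge0// invf_lt1// ltr1n.
have /cvgrPdist_lt/(_ _ (divr_gt0 e10 M0))[n _ /(_ n (leqnn _))/=] := cvg_expr h1.
rewrite sub0r normrN ger0_norm ?exprn_ge0// ltr_pdivlMr// => hn.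
exists (adjoint (bop_comp (T - bop_comp (r n) T) (T - bop_comp (r n) T)) y).
  exists (bop_comp (T - bop_comp (r n) T) (T - bop_comp (r n) T)) => //.
  apply: sum_squares1; apply: algebraB => //; apply: algebraM => //.
  exact: sqrt_iter_algebra.
rewrite (sqrt_iter_square algA commA n Aa AT) -adjoint_comp Tr -/r.
rewrite !adjoint_addl adjoint_oppl addrAC subrr add0r.
apply: le_lt_trans hn; apply: le_trans (adjoint_norm _ _) _.
have h2 : `|bop_comp (2 *: (r n.+1 - r n)) (bop_comp T T)| <= 2 * 2^-1 ^+ n * `|bop_comp T T|.
  apply: le_trans (bop_comp_norm _ _) _; rewrite ler_wpM2r// normrZ ger0_norm//.
  by rewrite ler_wpM2l//; exact: sqrt_iter_step.
apply: le_trans (ler_wpM2r (normr_ge0 y) h2) _.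
have : (0 : R) <= 2^-1 ^+ n by rewrite exprn_ge0.
rewrite /M; move: (2^-1 ^+ n) (`|bop_comp T T|) (`|y|) => p q s p0; nra.
Qed.

End SumsOfSquares.

(** * Conclusion *)

Section CalkinCase.
Context {R : realType} {X : completeNormedModType R}.
Variables (A : set (bounded_op X X)).
Hypotheses (infX : infinite_dimensional X) (algA : subalgebra A) (commA : commuting A).
Hypothesis realA : forall T, A T -> essentially_real T.
Hypothesis irrA : forall L : set (dual X), closed L -> linear_subspace L ->
  (forall T, A T -> forall f, L f -> L (adjoint T f)) -> L = [set 0] \/ L = setT.
Implicit Types (S T V W : bounded_op X X) (f g z : dual X).

(** The closure of the orbit is an invariant subspace. Were it zero, all adjoints would kill [f] and
    the line through [f] would be invariant and proper. *)
Lemma orbit_dense f v (e : R) : f != 0 -> 0 < e -> exists2 T, A T & `|adjoint T f - v| < e.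
Proof.
move=> f0 e0.
pose O := [set adjoint T f | T in A].
have OA T : A T -> O (adjoint T f) by exists T.
have linO : linear_subspace O.
  split=> [|a _ _ [S AS <-] [T AT <-]].
    by exists 0; [case: algA|rewrite adjoint0l].
  by rewrite -adjoint_scalel -adjoint_addl; apply: OA; apply: algebraD => //; exact: algebraZ.
have [|cO0|cOT] := irrA (@closed_closure _ O) (closure_linear_subspace linO).
- move=> T AT g; apply: (@closure_map _ _ _ _ _ _ `|T|).
    by move=> u w; exact: adjoint_lip.
  move=> _ [S AS <-]; rewrite -adjoint_comp; apply: subset_closure; apply: OA.
  exact: algebraM.
- have Af T : A T -> adjoint T f = 0.
    move=> AT; have : closure O (adjoint T f) by apply: subset_closure; exact: OA.
    by rewrite cO0.
  have [w [x [fx wx]]] := not_proportional infX f.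
  have [y fy] := dual_neq0 f0.
  (* The line through [f], written as the annihilator of its kernel so that [annihilator_closed]
     applies. *)
  pose L := [set g : dual X | forall u, [set u | (f u : R) = 0] u -> (g u : R) = 0].
  have Lprop g : L g -> g = ((g y : R) / (f y : R)) *: f.
    move=> Lg; apply: bop_ext => u; rewrite bopZ /GRing.scale/=.
    have := Lg (u - ((f u : R) / (f y : R)) *: y).
    rewrite /= !linearB !linearZ /= /GRing.scale/= !mulrN divfK// subrr.
    move=> /(_ erefl)/eqP; rewrite subr_eq0 => /eqP ->.
    by rewrite mulrAC -mulrA [RHS]mulrC.
  have [|||L0|LT] := @irrA L.
  + exact: annihilator_closed.
  + split=> [u _|a g h Lg Lh u fu]; first by [].
    by rewrite bopD bopZ Lg// Lh// addr0 /GRing.scale/= mulr0.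
  + move=> T AT g /Lprop ->; rewrite linearZ /= Af// scaler0.
    by move=> u _.
  + have : L f by move=> u.
    by rewrite L0 => /eqP; rewrite (negbTE f0).
  + have Lw : L w by rewrite LT.
    by move: wx; rewrite (Lw x fx) eqxx.
- have : closure O v by rewrite cOT.
  by move=> /closure_normP/(_ _ e0)[_ [T AT <-] h]; exists T.
Qed.

Definition small_orbit f := closure [set adjoint T f | T in [set T | A T /\ essential_norm T < 8^-1]].

(** T(1 - eW) / (1 + eta e) is again in [A] with essential norm below 1/8. *)
Lemma small_orbit_contract f z W (eta : R) : A W -> ess_pos W -> small_orbit f z -> 0 < eta ->
  exists2 d : R, 0 < d & forall e, 0 < e -> e < d ->
    small_orbit f ((1 + eta * e)^-1 *: (z - e *: adjoint W z)).
Proof.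
move=> AW pW Fz eta0; have [d d0 hd] := pW _ eta0; exists d => // e e0 ed.
have k0 : 0 < 1 + eta * e by rewrite addr_gt0// mulr_gt0.
pose V := bop_id X - e *: W.
have VE h : h - e *: adjoint W h = adjoint V h.
  by rewrite adjoint_addl adjoint_oppl adjoint_scalel adjoint_id.
rewrite VE; move: Fz.
apply: (@closure_map _ _ _ _ _ (fun z => (1 + eta * e)^-1 *: adjoint V z) (`|(1 + eta * e)^-1| * `|V|)).
  move=> u v; rewrite -scalerBr normrZ -mulrA ler_wpM2l//.
  exact: adjoint_lip.
move=> _ [T [AT T8] <-]; rewrite -adjoint_comp -adjoint_scalel; apply: subset_closure.
exists ((1 + eta * e)^-1 *: bop_comp T V); [split|reflexivity].
  apply: algebraZ => //; have -> : bop_comp T V = T - e *: bop_comp T W.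
    rewrite /V bop_compDr -scaleN1r bop_compZr bop_compZr scaleN1r; congr (_ - _).
    exact: bop_ext.
  by apply: algebraB => //; apply: algebraZ => //; exact: algebraM.
have := essential_norm_comp_lt k0 T8 (hd _ e0 ed).
move=> /(essential_normZ_lt (c := (1 + eta * e)^-1)).
by rewrite invr_gt0 => /(_ k0); rewrite mulrCA mulVf ?mulr1// gt_eqF.
Qed.

(* Extremality of [y] in the drop from [u] and approximate invariance of the orbit under
   [1 - e W^*] for sums of squares [W] keep [y - u] out of the cone. *)
Lemma square_cone_proper f f0 : f != 0 -> f0 != 0 ->
  (forall T, A T -> essential_norm T < 8^-1 -> 2^-1 <= `|adjoint T f - f0|) ->
  exists2 y, y != 0 & exists g, ~ square_cone A y g.
Proof.
move=> fn0 f0n0 far.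
have nF : ~ small_orbit f f0.
  move=> /closure_normP/(_ 2^-1)[|_ [T [AT T8] <-]]; first by rewrite invr_gt0.
  by apply/negP; rewrite -leNgt; exact: far.
have nf0 : 0 < `|f0| by rewrite normr_gt0.
have [T AT Tf] := orbit_dense f0 fn0 nf0.
(* Chosen so that [t *: T] has norm, hence essential norm, below 1/8. *)
pose t : R := (8 * (`|T| + 1))^-1.
have t0 : 0 < t by rewrite invr_gt0 mulr_gt0// ltr_pwDr.
have Tt : `|T| * t < 8^-1.
  rewrite /t invfM mulrCA -[ltRHS]mulr1 ltr_pM2l ?invr_gt0//.
  by rewrite ltr_pdivrMr ?mul1r ?ltrDl// ltr_pwDr.
have t1 : t <= 1.
  rewrite /t invf_le1 ?mulr_gt0 ?ltr_pwDr//; have := normr_ge0 T.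
  by move: `|T| => q; lra.
have Fc : small_orbit f (t *: adjoint T f).
  apply: subset_closure; exists (t *: T); last by rewrite adjoint_scalel.
  split; first exact: algebraZ.
  by apply: essential_norm_lt_norm; rewrite normrZ gtr0_norm// mulrC.
(* The drop starts strictly closer to [f0] than 0 is, so that its extremal point [y] is nonzero. *)
have cf0 : `|t *: adjoint T f - f0| < `|f0|.
  have -> : t *: adjoint T f - f0 = t *: (adjoint T f - f0) - (1 - t) *: f0.
    by rewrite scalerBr scalerBl scale1r opprB addrA subrK.
  apply: le_lt_trans (ler_normB _ _) _; rewrite !normrZ (gtr0_norm t0) ger0_norm ?subr_ge0//.
  have : t * `|adjoint T f - f0| < t * `|f0| by rewrite ltr_pM2l.
  by move: (`|f0|) (`|adjoint T f - f0|) => p q; lra.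
have [y [Fy yc yf0 drop]] := drop_point (@closed_closure _ _) Fc nF.
exists y.
  apply/eqP => y0; move: (le_lt_trans yc cf0); rewrite y0 sub0r normrN ltxx.
  by [].
exists (y - f0) => /closure_normP/(_ (`|y - f0| / 4)).
rewrite divr_gt0// => /(_ isT)[_ [W sW <-] hW].
set d := `|y - f0| in yf0 drop hW.
pose q := `|adjoint W y| + `|y| + 1.
have q0 : 0 < q by rewrite ltr_pwDr// addr_ge0.
(* This makes the total error eta (|W^* y| + |y|) at most d / 4. *)
pose eta := d / (4 * q).
have eta0 : 0 < eta by rewrite divr_gt0// mulr_gt0.
have [d1 d10 hd1] := small_orbit_contract (sum_squares_algebra algA sW)
  (sum_squares_ess_pos realA sW) Fy eta0.
pose e := Num.min 1 (d1 / 2).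
have e0 : 0 < e by rewrite lt_min ltr01 divr_gt0.
have e1 : e <= 1 by rewrite ge_min lexx.
have ed : e < d1.
  apply: le_lt_trans (_ : d1 / 2 < _); first by rewrite ge_min lexx orbT.
  by rewrite ltr_pdivrMr// mulr_natr mulr2n ltrDl.
have k0 : 0 < 1 + eta * e by rewrite addr_gt0// mulr_gt0.
have k1 : 1 <= 1 + eta * e by rewrite lerDl mulr_ge0// ltW.
pose k := (1 + eta * e)^-1.
have kk : k * (1 + eta * e) = 1 by rewrite mulVf// gt_eqF.
have kgt0 : 0 < k by rewrite invr_gt0.
have kle1 : k <= 1 by rewrite invf_le1.
(* This point b is within d / 2 of [f0], and y + e (b - y) = k (y - e W^* y) lies in the closed
   orbit, contradicting extremality. *)
apply: (drop (y - k *: (eta *: y + adjoint W y)) e _ e0 e1); last first.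
  have -> : y + e *: (y - k *: (eta *: y + adjoint W y) - y) =
      k *: (y - e *: adjoint W y).
    rewrite addrAC subrr add0r scalerN scalerA scalerDr scalerA scalerBr scalerA opprD addrA.
    rewrite (mulrC k e); congr (_ - _).
    rewrite -[X in X - _](scale1r y) -scalerBl; congr (_ *: _).
    by rewrite -{1}kk; ring.
  exact: hd1.
have -> : y - k *: (eta *: y + adjoint W y) - f0 =
    - (adjoint W y - (y - f0)) + (1 - k) *: adjoint W y - (k * eta) *: y.
  rewrite opprB scalerBl scale1r addrA subrK scalerDr scalerA opprD.
  by rewrite addrAC -[RHS]addrA [in RHS](addrC (- (k *: _))).
apply: le_trans (ler_normB _ _) _; apply: le_trans (lerD (ler_normD _ _) (lexx _)) _.
have norm_scale (a : R) (g : dual X) : 0 <= a -> `|a *: g| = a * `|g|.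
  by move=> a0; rewrite normrZ ger0_norm.
rewrite normrN (norm_scale (1 - k)) ?subr_ge0// norm_scale; last by rewrite mulr_ge0// ltW.
have h1 : (1 - k) * `|adjoint W y| <= eta * `|adjoint W y|.
  rewrite ler_wpM2r//; have : 1 - k = k * (eta * e) by rewrite -{1}kk; ring.
  move=> ->; apply: le_trans (_ : 1 * (eta * 1) <= _); last by rewrite mul1r mulr1.
  by apply: ler_pM => //; [exact: ltW|rewrite mulr_ge0 ?ltW|rewrite ler_pM2l].
have h2 : k * eta * `|y| <= eta * `|y|.
  by rewrite ler_wpM2r// ler_piMl// ltW.
have h3 : eta * (`|adjoint W y| + `|y|) <= d / 4.
  have -> : d / 4 = eta * q by rewrite /eta; field; rewrite gt_eqF.
  by rewrite ler_pM2l// lerDl.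
apply: le_trans (lerD (lerD (ltW hW) h1) h2) _.
rewrite -addrA -mulrDr; apply: le_trans (lerD (lexx _) h3) _.
have -> : d / 4 + d / 4 = d / 2 by field.
exact: lexx.
Qed.

(** If the cone were proper, it would have a nonzero drop point z seen from some u outside. Density
    brings some b = (ST)^* z within |z - u| / 2 of u; as ST = P^2 - M^2, the segment from z to b
    starts inside the cone, against the drop property. *)
Lemma square_cone_improper y : y != 0 -> forall g, square_cone A y g.
Proof.
move=> y0 g0; apply: contrapT => nC.
have adj_n0 z : z != 0 -> exists2 S, A S & adjoint S z != 0.
  move=> z0; have nz : 0 < `|z| by rewrite normr_gt0.
  have [S AS Sz] := orbit_dense z z0 nz; exists S => //.
  by apply/eqP => Sz0; move: Sz; rewrite Sz0 sub0r normrN ltxx.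
(* Some (ST)^* y is nonzero, so by polarization one of the two squares does not kill [y]. *)
have [c Cc c0] : exists2 c, square_cone A y c & c != 0.
  have [S AS Sy] := adj_n0 _ y0; have [T AT TSy] := adj_n0 _ Sy.
  pose P := 2^-1 *: (S + T); pose M := 2^-1 *: (S - T).
  have AP : A P by apply: algebraZ => //; exact: algebraD.
  have AM : A M by apply: algebraZ => //; exact: algebraB.
  have [Py|Py] := eqVneq (adjoint (bop_comp P P) y) 0; last first.
    by exists (adjoint (bop_comp P P) y) => //; exact: square_cone1.
  exists (adjoint (bop_comp M M) y); first exact: square_cone1.
  move: TSy; rewrite -adjoint_comp (bop_polarization (commA AS AT)) adjoint_addl Py.
  by rewrite adjoint_oppl add0r oppr_eq0.
have clC : closed (square_cone A y) by exact: closed_closure.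
have CZ a f : 0 <= a -> square_cone A y f -> square_cone A y (a *: f).
  exact: square_coneZ.
have [u [c' [nCu Cc' c'u]]] := cone_exit infX clC CZ Cc c0 nC.
have [z [Cz zc' zu drop]] := drop_point clC Cc' nCu.
have z0 : z != 0.
  apply/eqP => z0; move: (le_lt_trans zc' c'u); rewrite z0 sub0r normrN ltxx.
  by [].
have [S AS Sz] := adj_n0 _ z0.
have [T AT TSz] := orbit_dense u Sz (divr_gt0 zu (ltr0n R 2)).
pose P := 2^-1 *: (S + T); pose M := 2^-1 *: (S - T).
have AP : A P by apply: algebraZ => //; exact: algebraD.
have AM : A M by apply: algebraZ => //; exact: algebraB.
pose m := `|bop_comp M M|.
(* Both t and t m are at most 1/4, so (t / (1 - t)) m <= 1/3, within the bound 1/2 of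
   [square_cone_sub_square]. *)
pose t : R := (4 * (m + 1))^-1.
have m0 : 0 <= m by exact: normr_ge0.
have m10 : 0 < 4 * (m + 1) by rewrite mulr_gt0// ltr_pwDr.
have t0 : 0 < t by rewrite invr_gt0.
have t4 : t <= 4^-1.
  by rewrite /t lef_pV2 ?posrE// -[leLHS]mulr1 ler_pM2l// lerDr.
have tm : t * m <= 4^-1.
  rewrite /t mulrC ler_pdivrMr// mulrA mulVf// mul1r lerDl.
  exact: ler01.
have t1 : t <= 1 by apply: le_trans t4 _; rewrite invf_le1// ler1n.
have t1' : 0 < 1 - t by rewrite subr_gt0 (le_lt_trans t4)// invf_lt1// ltr1n.
apply: (drop _ t (ltW TSz) t0 t1).
rewrite -adjoint_comp (bop_polarization (commA AS AT)) -/P -/M adjoint_addl adjoint_oppl.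
have -> : z + t *: (adjoint (bop_comp P P) z - adjoint (bop_comp M M) z - z) =
    t *: adjoint (bop_comp P P) z +
    (1 - t) *: (z - (t / (1 - t)) *: adjoint (bop_comp M M) z).
  rewrite !scalerBr scalerA mulrCA divff ?gt_eqF// mulr1 scalerBl scale1r.
  rewrite [LHS]addrC -!addrA; congr (_ + _).
  by rewrite addrC (addrC (- (t *: z))) -addrA.
apply: square_coneD.
  by apply: square_coneZ; [|exact: ltW|exact: square_cone_square].
apply: square_coneZ => //; first exact: ltW.
apply: square_cone_sub_square => //; first by rewrite divr_ge0// ltW.
rewrite -/m mulrAC ler_pdivrMr//; apply: le_trans tm _.
rewrite mulrBr mulr1; move: t4; clear; move: t => t; lra.
Qed.

End CalkinCase.

Theorem theorem2p1 (R : realType) (X : completeNormedModType R)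
    (infX : infinite_dimensional X) (A : set (bounded_op X X))
    (algA : subalgebra A) (commA : commuting A)
    (realA : forall T, A T -> essentially_real T) :
  exists L : set (dual X),
    [/\ closed L, linear_subspace L, L <> [set 0], L <> setT &
        forall T, A T -> forall f, L f -> L (adjoint T f)].
Proof.
apply: contrapT => noL.
have irrA (L : set (dual X)) : closed L -> linear_subspace L ->
    (forall T, A T -> forall f, L f -> L (adjoint T f)) -> L = [set 0] \/ L = setT.
  move=> clL linL invL; apply: contrapT => /not_orP[L0 LT].
  by apply: noL; exists L.
have [v [x [_ vx]]] := not_proportional infX 0.
have v0 : v != 0 by apply/eqP => v0; move: vx; rewrite v0 eqxx.
have nv : 0 < `|v| by rewrite normr_gt0.
(* Norm 2 keeps the ball of radius 1 around [f0] away from 0, so every [f] in it has a dense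
   orbit. *)
pose f0 : dual X := (2 / `|v|) *: v.
have nf0 : `|f0| = 2.
  by rewrite normrZ ger0_norm ?divr_ge0// divfK// gt_eqF.
apply: noL; apply: (compact_case infX commA (f0 := f0)); first by rewrite nf0 ltr1n.
move=> f f1; apply: contrapT => nT.
have far T : A T -> essential_norm T < 8^-1 -> 2^-1 <= `|adjoint T f - f0|.
  by move=> AT T8; rewrite leNgt; apply/negP => Tf; apply: nT; exists T.
have f0n0 : f0 != 0 by rewrite -normr_gt0 nf0.
have fn0 : f != 0.
  apply/eqP => f00; move: f1; rewrite f00 sub0r normrN nf0.
  by rewrite leNgt ltr1n.
have [y y0 [g]] := square_cone_proper infX algA realA irrA fn0 f0n0 far.
apply; exact: (square_cone_improper infX algA commA irrA).
Qed.
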